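(* Every primitive recursive function $f:\mathbb{N}^m\rightarrow\mathbb{N}$ is represented by a pure proof net $G_f$ under superlazy reduction, i.e., there is a pure proof net $G_f$ with one premise such that for all $n_1,\dots,n_m\in\mathbb{N}$, the net $G_f\smile\langle\overline{n_1},\dots,\overline{n_m}\rangle$ reduces by superlazy reduction $\leadsto^*$ to $\overline{f(n_1,\dots,n_m)}$.
   Context: Pure proof nets are untyped multiplicative-exponential Linear Logic proof nets in intuitionistic style (one proper conclusion and some premises, no explicit cut or axiom nodes), built from nodes $P,C,W,X,R_{\multimap},L_{\multimap},R_{\otimes},L_{\otimes},R_{!},L_{!},D,N$ (premise, conclusion, weakening, contraction, linear rules, box doors, dereliction, digging), with boxes. Derelicting tree: with costs $0$ for $X,W$, $-1$ for $D$, $+1$ for $N$ (path cost = sum over nodes including endpoints), a derelicting tree is a tree of $X,D,N,W$ nodes with root $w$, leaves labelled $D$ or $W$, every path from $w$ to a $D$-leaf of cost $-1$, every other path from $w$ of nonnegative cost. Superlazy reduction $\leadsto$ is the union of the surface (never inside a box) closures of the multiplicative steps $\multimap,\otimes$, the box-merging step $M$, and the step $XNDW$, in which a box whose conclusion is the root of a derelicting tree is replaced by one opened copy of its content per $D$-leaf (its premises connected to copies of the tree); $\leadsto^*$ is its reflexive-transitive closure. An $n$-bounded spine is the derelicting tree made of $n$ contraction ($X$) nodes, with $n$ dereliction leaves. The numeral $\overline{n}$ is the closed proof net encoding the Church numeral $\lambda f.\lambda x.f(\cdots(f\,x))$ ($n$ applications), whose argument $f$ of type $!(A\multimap A)$ is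 shared via an $n$-bounded spine feeding $n$ chained $L_{\multimap}$ nodes ($\overline 0$ erases the argument by a $W$ node). $\langle\overline{n_1}\rangle=\overline{n_1}$ and, for $m>1$, $\langle\overline{n_1},\dots,\overline{n_m}\rangle$ is obtained by plugging the conclusions of $\overline{n_1},\dots,\overline{n_m}$ into a cluster of $R_{\otimes}$ nodes. For $G$ with one premise and one conclusion, $G\smile\langle\overline{n_1},\dots,\overline{n_m}\rangle$ is the closed net obtained by plugging the conclusion of $\langle\overline{n_1},\dots,\overline{n_m}\rangle$ into the premise of $G$. *)

(* Defs.v *)
(* MathComp; [Permutation] and [Forall2] come from Stdlib. *)
From Stdlib Require Import List Permutation Relation_Operators.
From mathcomp Require Import all_boot all_order all_algebra.

Set Implicit Arguments.
Unset Strict Implicit.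
Unset Printing Implicit Defensive.

Import Order.TTheory GRing.Theory Num.Theory.

(* The (directed) edges of a graph are named by natural numbers; the names
   carry no meaning, see [net_iso]. *)
Definition wire := nat.

(* Every node lists the names of its edges.
   [Wn i], [Xn i o1 o2], [Dn i o], [Nn i o], [Lten i o1 o2] have one incoming
   edge [i]; [Rten a b o] has incoming edges [a], [b];
   [Rlol x b o] is the abstraction of the variable edge [x] (outgoing) in the
   body [b] (incoming);
   [Llol f a o] is the application of [f] to [a] (both incoming).
   [Box ds B j c] is a box with content [B]: each [(p, q)] in [ds] is an
   L_! node with outer incoming edge [p] and inner outgoing edge [q], and the
   R_! node has inner incoming edge [j] and outer outgoing edge [c].
   Names inside a box are local to the box: the only edges related to the
   surroundings are those of the L_! nodes and of the R_! node. *)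
Inductive node : Type :=
| Wn (i : wire)
| Xn (i o1 o2 : wire)
| Rlol (x b o : wire)
| Llol (f a o : wire)
| Rten (a b o : wire)
| Lten (i o1 o2 : wire)
| Dn (i o : wire)
| Nn (i o : wire)
| Box (ds : seq (wire * wire)) (B : seq node) (j c : wire).

(* The P nodes are given by their outgoing edges [prems], the unique C node by
   its incoming edge [concl]. *)
Record net : Type := Net {
  prems : seq wire;
  nodes : seq node;
  concl : wire
}.

Definition node_in (n : node) : seq wire :=
  match n with
  | Wn i => [:: i]
  | Xn i _ _ => [:: i]
  | Rlol _ b _ => [:: b]
  | Llol f a _ => [:: f; a]
  | Rten a b _ => [:: a; b]
  | Lten i _ _ => [:: i]
  | Dn i _ => [:: i]
  | Nn i _ => [:: i]
  | Box ds _ _ _ => unzip1 ds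
  end.

Definition node_out (n : node) : seq wire :=
  match n with
  | Wn _ => [::]
  | Xn _ o1 o2 => [:: o1; o2]
  | Rlol x _ o => [:: x; o]
  | Llol _ _ o => [:: o]
  | Rten _ _ o => [:: o]
  | Lten _ o1 o2 => [:: o1; o2]
  | Dn _ o => [:: o]
  | Nn _ o => [:: o]
  | Box _ _ _ c => [:: c]
  end.

(* Every edge has exactly one source and exactly one target. *)
Definition wf_ports (ps : seq wire) (B : seq node) (j : wire) : bool :=
  let src := ps ++ flatten (map node_out B) in
  let tgt := j :: flatten (map node_in B) in
  uniq src && perm_eq src tgt.

Fixpoint wf_node (n : node) : bool :=
  if n is Box ds B j _ then wf_ports (unzip2 ds) B j && all wf_node B
  else true.

Definition wf_net (G : net) : bool :=
  wf_ports (prems G) (nodes G) (concl G) && all wf_node (nodes G).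

Definition ren_node (f : wire -> wire) (n : node) : node :=
  match n with
  | Wn i => Wn (f i)
  | Xn i o1 o2 => Xn (f i) (f o1) (f o2)
  | Rlol x b o => Rlol (f x) (f b) (f o)
  | Llol g a o => Llol (f g) (f a) (f o)
  | Rten a b o => Rten (f a) (f b) (f o)
  | Lten i o1 o2 => Lten (f i) (f o1) (f o2)
  | Dn i o => Dn (f i) (f o)
  | Nn i o => Nn (f i) (f o)
  | Box ds B j c => Box [seq (f d.1, d.2) | d <- ds] B j (f c)
  end.

Definition ren (f : wire -> wire) (G : net) : net :=
  Net (map f (prems G)) (map (ren_node f) (nodes G)) (f (concl G)).

Definition is_box (n : node) : bool := if n is Box _ _ _ _ then true else false.

(* [nodes_iso rho B B']: [B'] is [B], renamed by [rho] and reordered, where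
   the content of each box may in turn be renamed and reordered. *)
Inductive nodes_iso : (wire -> wire) -> seq node -> seq node -> Prop :=
| iso_nil rho : nodes_iso rho [::] [::]
| iso_plain rho n B B' :
    ~~ is_box n -> nodes_iso rho B B' ->
    nodes_iso rho (n :: B) (ren_node rho n :: B')
| iso_box rho theta ds ds' C C' j c B B' :
    injective theta -> nodes_iso theta C C' ->
    perm_eq ds' [seq (rho d.1, theta d.2) | d <- ds] ->
    nodes_iso rho B B' ->
    nodes_iso rho (Box ds C j c :: B) (Box ds' C' (theta j) (rho c) :: B')
| iso_perm rho B B' B'' :
    nodes_iso rho B B' -> Permutation B' B'' -> nodes_iso rho B B''.

Definition net_iso (G H : net) : Prop :=
  exists rho : wire -> wire,
    [/\ injective rho,
        perm_eq (prems H) (map rho (prems G)),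
        nodes_iso rho (nodes G) (nodes H)
      & concl H = rho (concl G)].

Definition subst (u v w : wire) : wire := if w == u then v else w.

(* Merge the edge [u] with [v], and the edge [u'] with [v']; the four names
   need not be distinct. *)
Definition merge2 (u v u' v' : wire) (G : net) : net :=
  let f := subst u v in ren (subst (f u') (f v')) (ren f G).

(* In each rule, well-formedness of the conclusion expresses that the new edges are
   fresh and that the graphs put together have no other edges in common. *)
Inductive proof_net : net -> Prop :=
| pn_iso G H : net_iso G H -> proof_net G -> proof_net H
| pn_wire w : proof_net (Net [:: w] [::] w)
| pn_cut ps qs G H w c :
    proof_net (Net ps G w) -> proof_net (Net (w :: qs) H c) ->
    wf_net (Net (ps ++ qs) (G ++ H) c) ->
    proof_net (Net (ps ++ qs) (G ++ H) c)
| pn_W ps G c i :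
    proof_net (Net ps G c) ->
    wf_net (Net (i :: ps) (Wn i :: G) c) ->
    proof_net (Net (i :: ps) (Wn i :: G) c)
| pn_X ps G c i o1 o2 :
    proof_net (Net (o1 :: o2 :: ps) G c) ->
    wf_net (Net (i :: ps) (Xn i o1 o2 :: G) c) ->
    proof_net (Net (i :: ps) (Xn i o1 o2 :: G) c)
| pn_Rlol ps G x b c :
    proof_net (Net (x :: ps) G b) ->
    wf_net (Net ps (Rlol x b c :: G) c) ->
    proof_net (Net ps (Rlol x b c :: G) c)
| pn_Llol ps qs G H f a o c :
    proof_net (Net ps G a) -> proof_net (Net (o :: qs) H c) ->
    wf_net (Net (f :: ps ++ qs) (Llol f a o :: G ++ H) c) ->
    proof_net (Net (f :: ps ++ qs) (Llol f a o :: G ++ H) c)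
| pn_Rten ps qs G H a b c :
    proof_net (Net ps G a) -> proof_net (Net qs H b) ->
    wf_net (Net (ps ++ qs) (Rten a b c :: G ++ H) c) ->
    proof_net (Net (ps ++ qs) (Rten a b c :: G ++ H) c)
| pn_Lten ps G c i o1 o2 :
    proof_net (Net (o1 :: o2 :: ps) G c) ->
    wf_net (Net (i :: ps) (Lten i o1 o2 :: G) c) ->
    proof_net (Net (i :: ps) (Lten i o1 o2 :: G) c)
| pn_box ds B j c :
    proof_net (Net (unzip2 ds) B j) ->
    wf_net (Net (unzip1 ds) [:: Box ds B j c] c) ->
    proof_net (Net (unzip1 ds) [:: Box ds B j c] c)
| pn_D ps G c i o :
    proof_net (Net (o :: ps) G c) ->
    wf_net (Net (i :: ps) (Dn i o :: G) c) ->
    proof_net (Net (i :: ps) (Dn i o :: G) c)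
| pn_N ps G c i o :
    proof_net (Net (o :: ps) G c) ->
    wf_net (Net (i :: ps) (Nn i o :: G) c) ->
    proof_net (Net (i :: ps) (Nn i o :: G) c).

Inductive xtree : Type :=
| LeafW
| LeafD
| NodeX (l r : xtree)
| NodeD (t : xtree)
| NodeN (t : xtree).

Inductive label : Type := LX | LD | LN | LW.

Definition cost (l : label) : int :=
  match l with LX | LW => 0%R | LD => (-1)%R | LN => 1%R end.

Definition path_cost (p : seq label) : int := (\sum_(l <- p) cost l)%R.

(* All paths from the root, each with a flag telling whether it ends in a
   leaf labelled D. *)
Fixpoint root_paths (t : xtree) : seq (seq label * bool) :=
  let below l ps := ([:: l], false) :: [seq (l :: p.1, p.2) | p <- ps] in
  match t with
  | LeafW => [:: ([:: LW], false)]
  | LeafD => [:: ([:: LD], true)]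
  | NodeX l r => below LX (root_paths l ++ root_paths r)
  | NodeD t' => below LD (root_paths t')
  | NodeN t' => below LN (root_paths t')
  end.

Definition derelicting (t : xtree) : bool :=
  all (fun p : seq label * bool =>
         if p.2 then path_cost p.1 == (-1)%R else (0 <= path_cost p.1)%R)
      (root_paths t).

(* [tree_at t i os T]: the nodes [T] form a tree of shape [t] whose root has
   incoming edge [i] and whose D-leaves have, from left to right, the outgoing
   edges [os]. *)
Inductive tree_at : xtree -> wire -> seq wire -> seq node -> Prop :=
| at_LeafW i : tree_at LeafW i [::] [:: Wn i]
| at_LeafD i o : tree_at LeafD i [:: o] [:: Dn i o]
| at_NodeX l r i o1 o2 os1 os2 T1 T2 :
    tree_at l o1 os1 T1 -> tree_at r o2 os2 T2 ->
    tree_at (NodeX l r) i (os1 ++ os2) (Xn i o1 o2 :: T1 ++ T2)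
| at_NodeD t i o os T :
    tree_at t o os T -> tree_at (NodeD t) i os (Dn i o :: T)
| at_NodeN t i o os T :
    tree_at t o os T -> tree_at (NodeN t) i os (Nn i o :: T).

(* As [G] and [ps], [k] are arbitrary, redexes are closed under all contexts
   which do not enclose them in a box. *)
Inductive contract : net -> net -> Prop :=
| contract_lol ps G k x b c a o :
    contract (Net ps (Rlol x b c :: Llol c a o :: G) k)
             (merge2 x a b o (Net ps G k))
| contract_ten ps G k a b c x y :
    contract (Net ps (Rten a b c :: Lten c x y :: G) k)
             (merge2 x a y b (Net ps G k))
(* Names inside boxes being local, the inner conclusion of the upper box can
   be given the name [i] of the inner edge of the L_! node it is plugged to. *)
| contract_M ps G k ds1 B1 ds2 B2 i c j c' :
    contract (Net ps (Box ds1 B1 i c :: Box ((c, i) :: ds2) B2 j c' :: G) k)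
             (Net ps (Box (ds1 ++ ds2) (B1 ++ B2) j c' :: G) k)
(* One copy [theta l] of the content [B] for each D-leaf [l < n] of the tree,
   the conclusion of this copy being the outgoing edge of the leaf; one copy of
   the tree for each premise of the box, the l-th leaf of which is connected to
   that premise of the l-th copy of [B]. The renamings [theta l] have to be
   injective on [B] and to have fresh, disjoint ranges: this is what the
   well-formedness of the reduct, required in [superlazy], amounts to. *)
| contract_XNDW ps G k ds B j c t T n (theta : nat -> wire -> wire) Ts :
    derelicting t ->
    tree_at t c (mkseq (fun l => theta l j) n) T ->
    Forall2 (fun d Td =>
               tree_at t d.1 (mkseq (fun l => theta l d.2) n) Td) ds Ts ->
    contract (Net ps (Box ds B j c :: T ++ G) k)
             (Net ps (flatten (mkseq (fun l => map (ren_node (theta l)) B) n)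
                      ++ flatten Ts ++ G) k).

Definition superlazy (G H : net) : Prop :=
  exists G' H', [/\ net_iso G G', contract G' H', wf_net H' & net_iso H' H].

(* Nets are considered up to isomorphism, also in reductions of length 0. *)
Definition superlazy_star (G H : net) : Prop :=
  exists2 H', clos_refl_trans net superlazy G H' & net_iso H' H.

(* The spine hanging from the edge [4 * 0 + 2]: each of [n] contractions has a
   dereliction as first successor and the rest of the spine as second one; the
   last contraction is followed by a weakening. *)
Definition spine (n : nat) : seq node :=
  flatten (mkseq (fun i => [:: Xn (4 * i + 2) (4 * i + 3) (4 * i.+1 + 2);
                               Dn (4 * i + 3) (4 * i + 4)]) n)
  ++ [:: Wn (4 * n + 2)].

(* The i-th dereliction is the function of the i-th outermost application. *)
Definition numeral (n : nat) : net :=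
  Net [::]
      (Rlol (4 * 0 + 2) 1 0 :: Rlol (4 * n + 5) (4 * 0 + 5) 1
       :: spine n
       ++ mkseq (fun i => Llol (4 * i + 4) (4 * i.+1 + 5) (4 * i + 5)) n)
      0.

(* Join two nets, made disjoint, by an R_(x) node. *)
Definition tensor (G H : net) : net :=
  let G' := ren (fun w => w.*2.+1) G in
  let H' := ren (fun w => w.*2.+2) H in
  Net (prems G' ++ prems H')
      (Rten (concl G') (concl H') 0 :: nodes G' ++ nodes H') 0.

Fixpoint numerals (n : nat) (ns : seq nat) : net :=
  match ns with
  | [::] => numeral n
  | n' :: ns' => tensor (numeral n) (numerals n' ns')
  end.

(* Plug the conclusion of [H] into the first premise of [G] (if any). *)
Definition plug (G H : net) : net :=
  let G' := ren double G in
  let H' := ren (fun w => w.*2.+1) H in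
  match prems G' with
  | [::] => G
  | p :: ps =>
      let H'' := ren (subst (concl H') p) H' in
      Net (prems H'' ++ ps) (nodes H'' ++ nodes G') (concl G')
  end.

Inductive primitive_recursive :
    forall m : nat, (m.-tuple nat -> nat) -> Prop :=
| pr_zero m : @primitive_recursive m (fun=> 0)
| pr_succ : @primitive_recursive 1 (fun t => (thead t).+1)
| pr_proj m (i : 'I_m) : @primitive_recursive m (fun t => tnth t i)
| pr_comp k m (g : k.-tuple nat -> nat) (h : 'I_k -> m.-tuple nat -> nat) :
    primitive_recursive g -> (forall i, primitive_recursive (h i)) ->
    primitive_recursive (fun t => g [tuple h i t | i < k])
| pr_rec m (g : m.-tuple nat -> nat) (h : m.+2.-tuple nat -> nat) :
    primitive_recursive g -> primitive_recursive h ->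
    @primitive_recursive m.+1
      (fun t => let s := [tuple of behead t] : m.-tuple nat in
                nat_rect (fun=> nat) (g s)
                  (fun k r => h [tuple of k :: r :: s]) (thead t))
| pr_ext m (f g : m.-tuple nat -> nat) :
    f =1 g -> primitive_recursive f -> primitive_recursive g.

(* Main.v *)
(* Values are numerals and binary tensors of values, programs are nets with one
   premise.  The programs are closed under composition, under acting on the
   first component of a pair, and under iteration: cutting a numeral against a
   box with content F turns its spine into a derelicting tree rooted at the box,
   so one XNDW step opens n chained copies of F.  Numerals are not boxes, but
   iteration also duplicates them (iterate the pair of successors from (0, 0))
   and erases them (iterate the identity); primitive recursion then iterates
   (k, r, s) |-> (k + 1, h (k, r, s), s).  All boxes are closed, so only the
   multiplicative steps and XNDW on spines occur. *)

From Stdlib Require Import Permutation Relation_Operators.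
Require Import Defs.
From mathcomp Require Import all_boot ssralg ssrnum ssrint zify.

Set Implicit Arguments.
Unset Strict Implicit.
Unset Printing Implicit Defensive.

(** * Renaming *)

(** The obstacle is naming: a multiplicative step merges edges and so renames everything around the
    redex, and opening a box requires fresh names. Correctness of a program ([computes]) is
    therefore stated for every renamed copy of it, next to arbitrary further nodes, and it reports
    the renaming that these nodes undergo. Such renamings may identify edges, and the correctness
    statements mention no freshness. This is sound because each step preserves well-formedness
    ([step_wf]); at the end, well-formedness of the result forces the renaming of the final numeral
    to be injective on its edges, which gives the isomorphism with [numeral]. Since iteration is
    driven by a numeral, it duplicates and erases numerals only; tuples are copied and erased entry
    by entry. *)

Lemma ren_node_comp f g n : ren_node f (ren_node g n) = ren_node (f \o g) n.
Proof. by case: n => //= ds B j c; rewrite -map_comp. Qed.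

Lemma map_ren_comp f g N :
  map (ren_node f) (map (ren_node g) N) = map (ren_node (f \o g)) N.
Proof. by rewrite -map_comp; apply: eq_map => n; exact: ren_node_comp. Qed.

Lemma eq_in_ren_node f g n :
  {in node_in n ++ node_out n, f =1 g} -> ren_node f n = ren_node g n.
Proof.
case: n => [i|i o p|x b o|h a o|a b o|i o p|i o|i o|ds B j c] e /=;
  try by rewrite !e // !inE eqxx ?orbT.
congr Box; last by apply: e; rewrite mem_cat inE eqxx orbT.
apply/eq_in_map => d dds; rewrite e //= mem_cat; apply/orP; left.
by apply/mapP; exists d.
Qed.

Lemma ren_node_id n : ren_node id n = n.
Proof.
by case: n => //= ds B j c; congr Box; rewrite -[RHS]map_id; apply: eq_map=> -[].
Qed.

Lemma map_ren_id N : map (ren_node id) N = N.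
Proof. by rewrite -[RHS]map_id; apply: eq_map => n; exact: ren_node_id. Qed.

Lemma node_in_ren f n : node_in (ren_node f n) = map f (node_in n).
Proof. by case: n => //= ds B j c; rewrite /unzip1 -!map_comp. Qed.

Lemma node_out_ren f n : node_out (ren_node f n) = map f (node_out n).
Proof. by case: n. Qed.

Lemma wf_node_ren f n : wf_node (ren_node f n) = wf_node n.
Proof. by case: n => //= ds B j c; rewrite /unzip2 -!map_comp. Qed.

Definition outs (N : seq node) : seq wire := flatten (map node_out N).
Definition ins (N : seq node) : seq wire := flatten (map node_in N).

Lemma outs_cons n N : outs (n :: N) = node_out n ++ outs N. Proof. by []. Qed.
Lemma ins_cons n N : ins (n :: N) = node_in n ++ ins N. Proof. by []. Qed.

Lemma outs_cat N N' : outs (N ++ N') = outs N ++ outs N'.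
Proof. by rewrite /outs map_cat flatten_cat. Qed.

Lemma ins_cat N N' : ins (N ++ N') = ins N ++ ins N'.
Proof. by rewrite /ins map_cat flatten_cat. Qed.

Lemma outs_ren f N : outs (map (ren_node f) N) = map f (outs N).
Proof.
by elim: N => //= n N IH; rewrite !outs_cons IH node_out_ren map_cat.
Qed.

Lemma ins_ren f N : ins (map (ren_node f) N) = map f (ins N).
Proof.
by elim: N => //= n N IH; rewrite !ins_cons IH node_in_ren map_cat.
Qed.

Lemma all_wf_ren f N : all wf_node (map (ren_node f) N) = all wf_node N.
Proof. by rewrite all_map; apply: eq_all => n /=; exact: wf_node_ren. Qed.

Lemma eq_in_map_ren f g N :
  {in ins N ++ outs N, f =1 g} -> map (ren_node f) N = map (ren_node g) N.
Proof.
elim: N => //= n N IH e; congr cons.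
  apply: eq_in_ren_node => w; rewrite mem_cat => wn; apply: e.
  by rewrite ins_cons outs_cons !mem_cat; case/orP: wn => ->; rewrite ?orbT.
apply: IH => w; rewrite mem_cat => wn; apply: e.
by rewrite ins_cons outs_cons !mem_cat; case/orP: wn => ->; rewrite ?orbT.
Qed.

Lemma eq_map_ren f g N : f =1 g -> map (ren_node f) N = map (ren_node g) N.
Proof. by move=> e; apply: eq_in_map_ren => w _. Qed.

(** * Permutations of node lists *)

Section Permutations.
Variable T : Type.
Implicit Types s t u : seq T.

Lemma Permutation_rot_cons x s t :
  Permutation s (t ++ [:: x]) -> Permutation s (x :: t).
Proof.
move=> p; apply: Permutation_trans p _.
by apply: Permutation_sym; exact: Permutation_cons_append.
Qed.

Lemma Permutation_rot_cat s t u :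
  Permutation s (t ++ u) -> Permutation s (u ++ t).
Proof. by move=> p; apply: Permutation_trans p _; exact: Permutation_app_comm. Qed.

Lemma Permutation_cat2l s t u :
  Permutation t u -> Permutation (s ++ t) (s ++ u).
Proof. exact: Permutation_app_head. Qed.

Lemma Permutation_cat2r s t u :
  Permutation t u -> Permutation (t ++ s) (u ++ s).
Proof. exact: Permutation_app_tail. Qed.

End Permutations.

(* Rotates the right-hand side until both sides start with the same item. *)
Ltac perm_match :=
  first [ exact: Permutation_refl
        | apply: perm_skip
        | apply: Permutation_cat2l
        | apply: Permutation_rot_cons; rewrite -?catA /=
        | apply: Permutation_rot_cat; rewrite -?catA /= ].
Ltac perm_solve := rewrite -?catA ?cats0 /= -?catA ?cats0 /=; do 100? perm_match.

Lemma Permutation_map_ren f N N' :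
  Permutation N N' -> Permutation (map (ren_node f) N) (map (ren_node f) N').
Proof. exact: Permutation_map. Qed.

Lemma perm_flatten (T : Type) (S : eqType) (g : T -> seq S) N N' :
  Permutation N N' -> perm_eq (flatten (map g N)) (flatten (map g N')).
Proof.
elim=> //= [x l l' _ IH|x y l|l l' l'' _ h1 _ h2].
- by rewrite perm_cat2l.
- by rewrite !catA perm_cat2r perm_catC.
- exact: perm_trans h1 h2.
Qed.

Lemma Permutation_all (T : Type) (a : pred T) N N' :
  Permutation N N' -> all a N = all a N'.
Proof.
by elim=> //= [x l l' _ ->|x y l|l l' l'' _ -> _ ->] //; rewrite andbCA.
Qed.

Lemma wf_netE ps N k :
  wf_net (Net ps N k) =
  [&& uniq (ps ++ outs N), perm_eq (ps ++ outs N) (k :: ins N)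
    & all wf_node N].
Proof. by rewrite /wf_net /wf_ports /= -andbA. Qed.

Lemma wf_net_perm ps ps' N N' k :
  perm_eq ps ps' -> Permutation N N' ->
  wf_net (Net ps N k) = wf_net (Net ps' N' k).
Proof.
move=> pp pN; rewrite !wf_netE (Permutation_all _ pN).
have po : perm_eq (ps ++ outs N) (ps' ++ outs N').
  by apply: perm_cat => //; exact: perm_flatten.
have pi : perm_eq (k :: ins N) (k :: ins N').
  by rewrite perm_cons; exact: perm_flatten.
by rewrite (perm_uniq po) (permPl po) (permPr pi).
Qed.

Lemma wf_net_ren f ps N k : injective f ->
  wf_net (Net ps N k) -> wf_net (Net (map f ps) (map (ren_node f) N) (f k)).
Proof.
move=> fi; rewrite !wf_netE all_wf_ren outs_ren ins_ren -map_cat -map_cons.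
by case/and3P=> u p ->; rewrite map_inj_uniq // u perm_map.
Qed.

(** * Isomorphisms *)

Fixpoint node_depth (n : node) : nat :=
  if n is Box _ B _ _ then (foldr maxn 0 (map node_depth B)).+1 else 0.

(** The content of a box needs an isomorphism of its own, here the identity. It comes from an
    induction on a bound on the nesting depth, as boxes contain lists of nodes. *)
Lemma nodes_iso_ren rho N : nodes_iso rho N (map (ren_node rho) N).
Proof.
have [d dN] : exists d, all (fun n => node_depth n < d) N.
  elim: N => [|n N [d IH]]; first by exists 0.
  exists (maxn d (node_depth n).+1) => /=; rewrite leq_maxr /=.
  by apply: sub_all IH => m; lia.
elim: d rho N dN => [|d IHd] rho; first by case=> //= _; constructor.
elim=> [|n N IHN] /=; first by constructor.
case/andP=> dn /IHN {}IHN.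
have [bn|] := boolP (is_box n); last by move=> nb; apply: iso_plain.
case: n dn bn => //= ds B j c dn _.
apply: (@iso_box rho id) => //.
  rewrite -{2}[B]map_ren_id; apply: IHd.
  elim: B dn => //= n B IH; rewrite ltnS gtn_max => /andP[-> h] /=.
  exact: IH.
Qed.

Lemma net_iso_ren rho ps N k ps' N' : injective rho ->
  perm_eq ps' (map rho ps) -> Permutation N' (map (ren_node rho) N) ->
  net_iso (Net ps N k) (Net ps' N' (rho k)).
Proof.
move=> ri pp pN; exists rho; split => //=.
by apply: iso_perm (nodes_iso_ren _ _) _; exact: Permutation_sym.
Qed.

Lemma net_iso_perm ps ps' N N' k : perm_eq ps' ps -> Permutation N N' ->
  net_iso (Net ps N k) (Net ps' N' k).
Proof.
move=> pp pN; apply: (@net_iso_ren id) => //; first by rewrite map_id.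
by rewrite map_ren_id; exact: Permutation_sym.
Qed.

Lemma net_iso_refl G : net_iso G G.
Proof. by case: G => ps N k; exact: net_iso_perm. Qed.

Lemma proof_net_perm ps ps' N N' k : perm_eq ps' ps -> Permutation N N' ->
  proof_net (Net ps N k) -> proof_net (Net ps' N' k).
Proof. by move=> pp pN; apply: pn_iso; exact: net_iso_perm. Qed.

Lemma proof_net_prems ps' ps N k :
  proof_net (Net ps N k) -> perm_eq ps' ps -> proof_net (Net ps' N k).
Proof. by move=> pn pp; apply: proof_net_perm pn; first exact: pp. Qed.

Lemma proof_net_ren f ps N k : injective f -> proof_net (Net ps N k) ->
  proof_net (Net (map f ps) (map (ren_node f) N) (f k)).
Proof. by move=> fi; apply: pn_iso; exact: net_iso_ren. Qed.

(** * Superlazy reduction of closed nets *)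

(** The renaming performed by [merge2], isolated so that it can be composed with others. *)
Definition merge (u v u' v' w : wire) : wire :=
  subst (subst u v u') (subst u v v') (subst u v w).

Lemma merge_l u v u' v' : merge u v u' v' u = merge u v u' v' v.
Proof. by congr subst; rewrite /subst eqxx; case: eqP. Qed.

Lemma merge_r u v u' v' : merge u v u' v' u' = merge u v u' v' v'.
Proof. by rewrite /merge {1}/subst eqxx [in RHS]/subst; case: eqP => // ->. Qed.

Lemma merge2E u v u' v' ps N k :
  merge2 u v u' v' (Net ps N k) =
  Net (map (merge u v u' v') ps) (map (ren_node (merge u v u' v')) N)
      (merge u v u' v' k).
Proof. by rewrite /merge2 /ren /= map_ren_comp -map_comp. Qed.

(* Names of the [l]-th copy of a box content with conclusion [j]: [os] are the
   leaves, and all other edges are numbered from [M] on. *)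
Definition copy_wire (M : nat) (os : seq wire) (j : wire) (l : nat) (w : wire) :=
  if w == j then nth 0 os l else M + (w * size os + l).

Definition copies M os j B :=
  flatten (mkseq (fun l => map (ren_node (copy_wire M os j l)) B) (size os)).

(** Superlazy steps on closed nets and premise-free boxes, with a canonical choice of copies.
    Well-formedness of the reduct is not demanded, as [step_wf] derives it. Bounding outgoing edges
    by [M] bounds all edges, since in a closed well-formed net every edge leaves some node. *)
Inductive step : seq node -> wire -> seq node -> wire -> Prop :=
| step_lol N k x b c a o G :
    Permutation N (Rlol x b c :: Llol c a o :: G) ->
    step N k (map (ren_node (merge x a b o)) G) (merge x a b o k)
| step_ten N k a b c x y G :
    Permutation N (Rten a b c :: Lten c x y :: G) ->
    step N k (map (ren_node (merge x a y b)) G) (merge x a y b k)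
| step_box N k B j c t os T G M :
    Permutation N (Box [::] B j c :: T ++ G) ->
    derelicting t -> tree_at t c os T ->
    all (fun w => w < M) (outs N) ->
    step N k (copies M os j B ++ G) k.

Inductive steps : seq node -> wire -> seq node -> wire -> Prop :=
| steps_perm N N' k : Permutation N N' -> steps N k N' k
| steps_step N k N1 k1 N2 k2 :
    step N k N1 k1 -> steps N1 k1 N2 k2 -> steps N k N2 k2.

Lemma step_perm_l N0 N k N' k' : Permutation N0 N ->
  step N k N' k' -> step N0 k N' k'.
Proof.
move=> p s; case: s p => {N k N' k'}.
- by move=> N k x b c a o G q p; apply: step_lol (Permutation_trans p q).
- by move=> N k a b c x y G q p; apply: step_ten (Permutation_trans p q).
- move=> N k B j c t os T G M q dt tt aM p.
  apply: step_box (Permutation_trans p q) dt tt _.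
  by rewrite (perm_all _ (perm_flatten node_out p)).
Qed.

Lemma steps_perm_l N0 N k N' k' : Permutation N0 N ->
  steps N k N' k' -> steps N0 k N' k'.
Proof.
move=> p s; case: s p => {N k N' k'}.
  by move=> N N' k q p; apply: steps_perm (Permutation_trans p q).
move=> N k N1 k1 N2 k2 s ss p; exact: steps_step (step_perm_l p s) ss.
Qed.

Lemma steps_trans N k N1 k1 N2 k2 :
  steps N k N1 k1 -> steps N1 k1 N2 k2 -> steps N k N2 k2.
Proof.
elim=> {N k N1 k1} [N N1 k p|N k N1 k1 N3 k3 s _ IH] h; first exact: steps_perm_l p h.
exact: steps_step s (IH h).
Qed.

Lemma steps_perm_r N k N' k' N'' : steps N k N' k' -> Permutation N' N'' ->
  steps N k N'' k'.
Proof. by move=> s p; apply: steps_trans s (steps_perm _ p). Qed.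


(** * Preservation of well-formedness by the steps *)

(** A cut elimination deletes two sources and two targets; the merge identifies them crosswise, so
    the remaining sources and targets still balance. *)
Lemma perm_merge (h : wire -> wire) p q r s S T :
  perm_eq (p :: q :: S) (r :: s :: T) -> h p = h s -> h q = h r ->
  perm_eq (map h S) (map h T).
Proof.
move=> /(perm_map h) /= pq hp hq; move: pq; rewrite hp hq.
by move=> pq; rewrite -(perm_cons (h r)) -(perm_cons (h s)) (permPl pq) (perm_catCA [:: _] [:: _]).
Qed.

(** On the surviving sources the merge only renames the body edge to [o], which is no longer among
    them. If [b] is [x] (identity abstraction), the renamed edge is [a]; [subst x a b] covers both
    cases. *)
Lemma uniq_merge_lol x a b o S :
  uniq (x :: o :: S) -> uniq (map (merge x a b o) S).
Proof.
rewrite /= inE negb_or => /and3P[/andP[xo xS] oS uS].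
have hE w : w \in S -> merge x a b o w = if w == subst x a b then o else w.
  move=> wS; rewrite /merge /subst; case: (w =P x) => [wx|_].
    by move: xS; rewrite -wx wS.
  by case: (o =P x) xo => [-> |//]; rewrite eqxx.
rewrite map_inj_in_uniq // => u v uS' vS; rewrite !hE //.
case: eqP => [->|_]; case: eqP => [->|_] // e.
  by move: vS; rewrite -e (negPf oS).
by move: uS'; rewrite e (negPf oS).
Qed.

(** Only [x] and [y] are renamed, and both lost their source node, so the merge is the identity on
    [S]. *)
Lemma uniq_merge_ten x a y b S :
  uniq (x :: y :: S) -> uniq (map (merge x a y b) S).
Proof.
rewrite /= inE negb_or => /and3P[/andP[xy xS] yS uS].
suff -> : map (merge x a y b) S = S by [].
rewrite -[RHS]map_id; apply/eq_in_map => w wS; rewrite /merge /subst.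
have /negPf-> : w != x by apply: contraNneq xS => <-.
have /negPf-> : y != x by rewrite eq_sym.
by have /negPf-> : w != y by apply: contraNneq yS => <-.
Qed.

Lemma tree_at_perm t c os T :
  tree_at t c os T -> perm_eq (c :: outs T) (ins T ++ os).
Proof.
elim=> {t c os T} //.
- move=> l r i o1 o2 os1 os2 T1 T2 _ IH1 _ IH2.
  rewrite outs_cons ins_cons /= perm_cons outs_cat ins_cat.
  apply/permP => P; move/permP: IH1 => /(_ P); move/permP: IH2 => /(_ P).
  by rewrite /= !count_cat /= ?count_cat; lia.
- by move=> t i o os T _ IH; rewrite outs_cons ins_cons /= perm_cons.
- by move=> t i o os T _ IH; rewrite outs_cons ins_cons /= perm_cons.
Qed.

Lemma copies_outs M os j B :
  outs (copies M os j B) =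
  [seq copy_wire M os j l w | l <- iota 0 (size os), w <- outs B].
Proof.
rewrite /copies /mkseq; elim: (iota _ _) => //= l s IH.
by rewrite outs_cat outs_ren IH.
Qed.

Lemma copy_wire_leaves M os j :
  mkseq (fun l => copy_wire M os j l j) (size os) = os.
Proof.
by rewrite -[RHS](mkseq_nth 0); apply: eq_mkseq => l; rewrite /copy_wire eqxx.
Qed.

Lemma copies_perm M os j B : perm_eq (outs B) (j :: ins B) ->
  perm_eq (outs (copies M os j B)) (os ++ ins (copies M os j B)).
Proof.
move=> pB; rewrite copies_outs.
rewrite -[X in X ++ _](copy_wire_leaves M os j) /copies /mkseq.
elim: (iota _ _) => //= l s IH.
rewrite ins_cat ins_ren.
apply/permP => P; move/permP: IH => /(_ P).
move/(perm_map (copy_wire M os j l)): pB => /permP/(_ P) /=.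
rewrite !count_cat /= => -> ->; rewrite -!addnA; congr addn; exact: addnCA.
Qed.

(** Leaves lie below [M] and all other copied edges do not. For the latter, division by [size os]
    recovers the original edge as quotient and the copy number as remainder. *)
Lemma copies_uniq M os j B : uniq os -> all (fun w => w < M) os ->
  uniq (outs B) -> uniq (outs (copies M os j B)).
Proof.
move=> uos /allP osM uB; rewrite copies_outs.
apply: allpairs_uniq => //; first exact: iota_uniq.
have lt l : l \in iota 0 (size os) -> l < size os by rewrite mem_iota.
move=> _ _ /allpairsP[[l w] /= [/lt lL _ ->]] /allpairsP[[l' w'] /= [/lt lL' _ ->]] /=.
rewrite /copy_wire; case: (w =P j) => [->|_]; case: (w' =P j) => [->|_].
- by move/eqP; rewrite nth_uniq // => /eqP->.
- by move=> e; have := osM _ (mem_nth 0 lL); rewrite e ltnNge leq_addr.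
- by move=> e; have := osM _ (mem_nth 0 lL'); rewrite -e ltnNge leq_addr.
move=> /eqP; rewrite eqn_add2l => /eqP e.
have s0 : 0 < size os by lia.
have := congr1 (divn^~ (size os)) e; have := congr1 (modn^~ (size os)) e.
by rewrite /= !divnMDl // !modnMDl !divn_small // !modn_small // !addn0 => -> ->.
Qed.

Lemma step_wf N k N' k' : step N k N' k' ->
  wf_net (Net [::] N k) -> wf_net (Net [::] N' k').
Proof.
case=> {N k N' k'}.
- move=> N k x b c a o G p; rewrite (wf_net_perm _ (perm_refl _) p) !wf_netE /=.
  rewrite !(outs_cons, ins_cons) all_wf_ren outs_ren ins_ren /= -map_cons.
  case/and3P => u pG ->; rewrite andbT; apply/andP; split.
    apply: uniq_merge_lol; move: u; rewrite /= !inE !negb_or.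
    by case/and4P => /and3P[_ -> ->] /andP[_ _] -> ->.
  apply: (@perm_merge _ x o b a); rewrite ?merge_l ?merge_r //.
  apply/permP => P; move/permP: pG => /(_ P) /=; lia.
- move=> N k a b c x y G p; rewrite (wf_net_perm _ (perm_refl _) p) !wf_netE /=.
  rewrite !(outs_cons, ins_cons) all_wf_ren outs_ren ins_ren /= -map_cons.
  case/and3P => u pG ->; rewrite andbT; apply/andP; split.
    apply: uniq_merge_ten; move: u; rewrite /= !inE !negb_or.
    by case/and4P => _ /andP[-> ->] -> ->.
  apply: (@perm_merge _ x y b a); rewrite ?merge_l ?merge_r //.
  apply/permP => P; move/permP: pG => /(_ P) /=; lia.
move=> N k B j c t os T G M p _ tT aM.
rewrite (perm_all _ (perm_flatten node_out p)) in aM.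
rewrite (wf_net_perm _ (perm_refl _) p) !wf_netE /=.
move: aM; rewrite -/(outs _) !(outs_cons, ins_cons) /=.
rewrite !outs_cat !ins_cat !all_cat /wf_ports /=.
rewrite -/(outs _) -/(ins _) -/(outs (T ++ G)) outs_cat all_cat.
move=> /and3P[cM TM GM] /and3P[uc pc /and3P[/andP[/andP[uB pB] wB] _ wG]].
have pT := tree_at_perm tT.
(* The leaves are edges of the tree, so they inherit distinctness and disjointness from [G] from its
   sources. *)
have uall : uniq (ins T ++ os ++ outs G).
  by rewrite catA -(perm_uniq (perm_cat pT (perm_refl (outs G)))).
have osM : all (fun w => w < M) os.
  have : all (fun w => w < M) (ins T ++ os) by rewrite -(perm_all _ pT) /= cM.
  by rewrite all_cat => /andP[].
move: uall; rewrite cat_uniq => /and3P[_ _]; rewrite cat_uniq => /and3P[uos dos uG].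
apply/and4P; split.
- rewrite cat_uniq copies_uniq // uG andbT /=; apply/hasPn => w wIn.
  rewrite copies_outs; apply/allpairsP => -[[l v] /= [lL _ e]].
  have {}lL : l < size os by rewrite mem_iota in lL.
  move: e; rewrite /copy_wire; case: eqP => _ e.
    by have /hasPn/(_ w wIn) := dos; rewrite e mem_nth.
  by move/allP: GM => /(_ w wIn); rewrite e ltnNge leq_addr.
- apply/permP => P; move/permP: pc => /(_ P); move/permP: pT => /(_ P).
  move/permP: (copies_perm M os pB) => /(_ P).
  clear -P; rewrite /= !count_cat /= ?count_cat; lia.
- by rewrite /copies /mkseq; elim: (iota _ _) => //= l s IH; rewrite all_cat all_wf_ren wB.
- exact: wG.
Qed.

Lemma step_superlazy N k N' k' : step N k N' k' ->
  wf_net (Net [::] N' k') -> superlazy (Net [::] N k) (Net [::] N' k').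
Proof.
case=> {N k N' k'}.
- move=> N k x b c a o G p wf.
  exists (Net [::] (Rlol x b c :: Llol c a o :: G) k), (merge2 x a b o (Net [::] G k)).
  rewrite merge2E; split=> //; [exact: net_iso_perm | |exact: net_iso_refl].
  by have := contract_lol [::] G k x b c a o; rewrite merge2E.
- move=> N k a b c x y G p wf.
  exists (Net [::] (Rten a b c :: Lten c x y :: G) k), (merge2 x a y b (Net [::] G k)).
  rewrite merge2E; split=> //; [exact: net_iso_perm | |exact: net_iso_refl].
  by have := contract_ten [::] G k a b c x y; rewrite merge2E.
move=> N k B j c t os T G M p dt tT _ wf.
exists (Net [::] (Box [::] B j c :: T ++ G) k), (Net [::] (copies M os j B ++ G) k).
split=> //; [exact: net_iso_perm | |exact: net_iso_refl].
(* The box has no premises, so no copy of the tree is created. *)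
apply: (@contract_XNDW [::] G k [::] B j c t T (size os) (copy_wire M os j) [::]) => //.
by rewrite copy_wire_leaves.
Qed.

(** A permutation of nodes is not a reduction step: the last one stays pending, to be absorbed by
    the isomorphism that closes [superlazy_star]. *)
Lemma steps_superlazy N k N' k' : steps N k N' k' -> wf_net (Net [::] N k) ->
  exists N'', [/\ clos_refl_trans net superlazy (Net [::] N k) (Net [::] N'' k'),
                  Permutation N'' N' & wf_net (Net [::] N' k')].
Proof.
elim=> {N k N' k'} [N N' k p wf|N k N1 k1 N2 k2 s _ IH wf].
  exists N; split=> //; first exact: rt_refl.
  by rewrite -(wf_net_perm _ (perm_refl _) p).
have wf1 := step_wf s wf; have [N'' [r p w]] := IH wf1.
exists N''; split=> //; apply: rt_trans r; apply: rt_step.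
exact: step_superlazy.
Qed.

(** * Numerals *)

Lemma mkseq_recl (T : Type) (f : nat -> T) n :
  mkseq f n.+1 = f 0 :: mkseq (f \o succn) n.
Proof. by rewrite /mkseq /= -[1]addn0 iotaDl -map_comp. Qed.

Definition apps (n : nat) : seq node :=
  mkseq (fun i => Llol (4 * i + 4) (4 * i.+1 + 5) (4 * i + 5)) n.

Lemma numeral_nodes n :
  nodes (numeral n) = Rlol 2 1 0 :: Rlol (4 * n + 5) 5 1 :: spine n ++ apps n.
Proof. by []. Qed.

(** A numeral uses four names per application, so dropping the outermost application amounts to this
    shift. *)
Definition shift4 (w : wire) : wire := w + 4.

Lemma spineS n :
  spine n.+1 = Xn 2 3 6 :: Dn 3 4 :: map (ren_node shift4) (spine n).
Proof.
rewrite /spine mkseq_recl /= map_cat /=; congr [:: _, _ & _].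
congr (_ ++ [:: Wn _]); last by rewrite /shift4; lia.
rewrite map_flatten /mkseq -map_comp; congr flatten; apply: eq_map => i /=.
by rewrite /shift4; congr [:: Xn _ _ _; Dn _ _]; lia.
Qed.

Lemma appsS n : apps n.+1 = Llol 4 9 5 :: map (ren_node shift4) (apps n).
Proof.
rewrite /apps mkseq_recl /=; congr cons.
rewrite /mkseq -map_comp; apply: eq_map => i /=.
by rewrite /shift4; congr Llol; lia.
Qed.

(** After [shift4] these edges are at least 6, the point where the renaming in [computes_succ]
    switches to the old numeral. *)
Lemma spine_wires_ge2 n : all (leq 2) (ins (spine n) ++ outs (spine n)).
Proof.
elim: n => // n; rewrite spineS !(ins_cons, outs_cons) ins_ren outs_ren /=.
rewrite !all_cat /= !all_map => /andP[hi ho]; apply/andP.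
by split; [move: hi|move: ho]; apply: sub_all => w /=; rewrite /shift4; lia.
Qed.

Lemma apps_wires_ge2 n : all (leq 2) (ins (apps n) ++ outs (apps n)).
Proof.
elim: n => // n; rewrite appsS !(ins_cons, outs_cons) ins_ren outs_ren /=.
rewrite !all_cat /= !all_map => /andP[hi ho]; apply/andP.
by split; [move: hi|move: ho]; apply: sub_all => w /=; rewrite /shift4; lia.
Qed.

Fixpoint spine_tree (n : nat) : xtree :=
  if n is n'.+1 then NodeX LeafD (spine_tree n') else LeafW.

(** Contractions cost nothing, so a path costs -1 if it ends in a dereliction and 0 otherwise. *)
Lemma derelicting_spine n : derelicting (spine_tree n).
Proof.
rewrite /derelicting; elim: n => [|n IH] /=.
  by rewrite /path_cost big_seq1.
rewrite /path_cost big_seq1 /= big_cons big_seq1 /= all_map.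
by apply: sub_all IH => -[p b] /=; rewrite /path_cost big_cons /= GRing.add0r.
Qed.

(** Leaf [i] is the function edge of application [i]. The renaming is arbitrary so that the
    induction can absorb [shift4] into it. *)
Lemma spine_tree_at n f :
  tree_at (spine_tree n) (f 2) (mkseq (fun i => f (4 * i + 4)) n)
          (map (ren_node f) (spine n)).
Proof.
elim: n f => [|n IH] f; first exact: at_LeafW.
rewrite spineS mkseq_recl /= map_ren_comp.
have -> : mkseq ((fun i => f (4 * i + 4)) \o succn) n =
          mkseq (fun i => (f \o shift4) (4 * i + 4)) n.
  by apply: eq_mkseq => i /=; congr f; rewrite /shift4; lia.
exact: (at_NodeX (f 2) (at_LeafD (f 3) (f 4)) (IH (f \o shift4))).
Qed.

Lemma spine0 : spine 0 = [:: Wn 2]. Proof. by []. Qed.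

Lemma apps0 : apps 0 = [::]. Proof. by []. Qed.

Lemma appsSr n :
  apps n.+1 = apps n ++ [:: Llol (4 * n + 4) (4 * n.+1 + 5) (4 * n + 5)].
Proof. by rewrite /apps mkseqS -cats1. Qed.

(** * Values *)

Inductive val := VN (n : nat) | VP (u v : val).

(** Not asking [f] to be injective makes values stable under merges; [isval_net_iso] recovers
    injectivity from well-formedness. *)
Inductive isval : val -> wire -> seq node -> Prop :=
| isval_num n f V :
    Permutation V (map (ren_node f) (nodes (numeral n))) -> isval (VN n) (f 0) V
| isval_pair u v a b c U V W :
    isval u a U -> isval v b V -> Permutation W (Rten a b c :: U ++ V) ->
    isval (VP u v) c W.

Lemma isval_ren f v w V : isval v w V -> isval v (f w) (map (ren_node f) V).
Proof.
elim=> {v w V} [n g V p|u v a b c U V W _ IHu _ IHv p].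
  by apply: (@isval_num n (f \o g)); rewrite -map_ren_comp; exact: Permutation_map_ren.
apply: isval_pair IHu IHv _.
by rewrite -map_cat; exact: (Permutation_map_ren f p).
Qed.

Lemma isval_perm v w V V' : Permutation V' V -> isval v w V -> isval v w V'.
Proof.
move=> p h; case: h p => {v w V} [n g V q|u v a b c U V W hu hv q] p.
  exact: isval_num (Permutation_trans p q).
exact: isval_pair hu hv (Permutation_trans p q).
Qed.

Lemma isval_pairE u v c W : isval (VP u v) c W ->
  exists a b U V,
    [/\ isval u a U, isval v b V & Permutation W (Rten a b c :: U ++ V)].
Proof.
by move=> h; inversion h; exists a, b, U, V.
Qed.

Lemma isval_numE n c V : isval (VN n) c V ->
  exists2 f, c = f 0 & Permutation V (map (ren_node f) (nodes (numeral n))).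
Proof. by move=> h; inversion h; exists f. Qed.

(** Here [f] renames the program, [R] is the rest of the net, and [h] records what the reduction
    does to the names in [R]. Quantifying over [f] and [R] is what lets programs be chained and
    boxes be opened. *)
Definition computes (N : seq node) (p c : wire) (v v' : val) : Prop :=
  forall f V R k, isval v (f p) V ->
  exists h V', steps (V ++ map (ren_node f) N ++ R) k
                     (V' ++ map (ren_node h) R) (h k)
               /\ isval v' (h (f c)) V'.

Lemma computes_id p v : computes [::] p p v v.
Proof.
move=> f V R k hv; exists id, V; rewrite map_ren_id; split=> //.
exact: steps_perm.
Qed.

Lemma computes_ren N p c v v' g : computes N p c v v' ->
  computes (map (ren_node g) N) (g p) (g c) v v'.
Proof. by move=> h f V R k hv; rewrite map_ren_comp; exact: h. Qed.

Lemma computes_comp N1 N2 p q c v1 v2 v3 :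
  computes N1 p q v1 v2 -> computes N2 q c v2 v3 ->
  computes (N1 ++ N2) p c v1 v3.
Proof.
move=> c1 c2 f V R k hv; rewrite map_cat -catA.
have [h [V' [s hv']]] := c1 f V (map (ren_node f) N2 ++ R) k hv.
(* While [N1] ran, [N2] was part of its surroundings, so it is now renamed by [h \o f]. *)
have [h' [V'' [s' hv'']]] := c2 (h \o f) V' (map (ren_node h) R) (h k) hv'.
exists (h' \o h), V''; split=> //; apply: steps_trans s _.
by move: s'; rewrite map_cat !map_ren_comp.
Qed.

Lemma unpair u v c W x y R k : isval (VP u v) c W ->
  exists h U V,
    [/\ steps (W ++ Lten c x y :: R) k (U ++ V ++ map (ren_node h) R) (h k),
        isval u (h x) U & isval v (h y) V].
Proof.
move=> /isval_pairE[a [b [U [V [hu hv p]]]]].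
pose h := merge x a y b.
exists h, (map (ren_node h) U), (map (ren_node h) V); split.
- apply: (@steps_step _ _ _ _ _ _ (@step_ten _ k a b c x y (U ++ V ++ R) _)).
    apply: Permutation_trans (Permutation_cat2r _ p) _; perm_solve.
  by apply: steps_perm; rewrite !map_cat; perm_solve.
- by rewrite /h merge_l; exact: isval_ren.
- by rewrite /h merge_r; exact: isval_ren.
Qed.

(** Two linear steps strip both abstractions: in a numeral, 2 is the function variable, [4 * n + 5]
    the argument variable and 5 the body. *)
Lemma apply_num n c V a1 o1 a2 o2 R k : isval (VN n) c V ->
  exists h t,
    [/\ steps (V ++ [:: Llol c a1 o1, Llol o1 a2 o2 & R]) k
              (map (ren_node t) (spine n ++ apps n) ++ map (ren_node h) R) (h k),
        t 2 = h a1, t (4 * n + 5) = h a2 & t 5 = h o2].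
Proof.
move=> /isval_numE[t -> p]; rewrite numeral_nodes /= in p.
move: (spine n ++ apps n) p => S p.
pose h1 := merge (t 2) a1 (t 1) o1.
pose h2 := merge (h1 (t (4 * n + 5))) (h1 a2) (h1 (t 5)) (h1 o2).
have e1 : h1 (t 1) = h1 o1 by rewrite /h1 merge_r.
exists (h2 \o h1), ((h2 \o h1) \o t); split=> /=.
- apply: (@steps_step _ _ _ _ _ _ (@step_lol _ k (t 2) (t 1) (t 0) a1 o1
    (Rlol (t (4 * n + 5)) (t 5) (t 1) :: Llol o1 a2 o2 ::
      map (ren_node t) S ++ R) _)).
    apply: Permutation_trans (Permutation_cat2r _ p) _; perm_solve.
  rewrite -/h1 /= e1.
  apply: (@steps_step _ _ _ _ _ _ (@step_lol _ (h1 k) (h1 (t (4 * n + 5)))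
    (h1 (t 5)) (h1 o1) (h1 a2) (h1 o2) _ (Permutation_refl _))).
  apply: steps_perm; rewrite !map_cat !map_ren_comp; exact: Permutation_refl.
- by congr h2; rewrite /h1 merge_l.
- by rewrite /h2 merge_l.
- by rewrite /h2 merge_r.
Qed.

(** * Programs for pairs, zero and successor *)

Definition swap_gate := [:: Lten 0 1 2; Rten 2 1 3].

Lemma computes_swap u v : computes swap_gate 0 3 (VP u v) (VP v u).
Proof.
move=> f W R k hW /=.
have [h [U [V [s hu hv]]]] := unpair (f 1) (f 2) (Rten (f 2) (f 1) (f 3) :: R) k hW.
exists h, (Rten (h (f 2)) (h (f 1)) (h (f 3)) :: V ++ U); split.
  by apply: steps_perm_r s _; perm_solve.
exact: isval_pair hv hu (Permutation_refl _).
Qed.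

Definition assoc_gate := [:: Lten 0 1 2; Lten 1 3 4; Rten 4 2 5; Rten 3 5 6].

Lemma computes_assoc u v w :
  computes assoc_gate 0 6 (VP (VP u v) w) (VP u (VP v w)).
Proof.
move=> f W R k hW /=.
have [h [P [C [s hP hC]]]] := unpair (f 1) (f 2)
  [:: Lten (f 1) (f 3) (f 4), Rten (f 4) (f 2) (f 5), Rten (f 3) (f 5) (f 6) & R] k hW.
have [h' [A [B [s' hA hB]]]] := unpair (h (f 3)) (h (f 4))
  (Rten (h (f 4)) (h (f 2)) (h (f 5)) :: Rten (h (f 3)) (h (f 5)) (h (f 6))
    :: C ++ map (ren_node h) R) (h k) hP.
exists (h' \o h).
exists (Rten (h' (h (f 3))) (h' (h (f 5))) (h' (h (f 6))) :: A ++
  (Rten (h' (h (f 4))) (h' (h (f 2))) (h' (h (f 5))) :: B ++ map (ren_node h') C)).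
split=> /=.
  apply: steps_trans s _; apply: steps_perm_l _ (steps_perm_r s' _).
    by rewrite /=; perm_solve.
  by rewrite /= !map_cat !map_ren_comp; perm_solve.
apply: isval_pair hA _ (Permutation_refl _).
exact: isval_pair hB (isval_ren _ hC) (Permutation_refl _).
Qed.

Definition zero_gate := [:: Rten 0 1 2; Rlol 3 4 1; Rlol 5 5 4; Wn 3].

Lemma computes_zero u : computes zero_gate 0 2 u (VP u (VN 0)).
Proof.
move=> f W R k hW; exists id, (W ++ map (ren_node f) zero_gate).
split; first by apply: steps_perm; rewrite map_ren_id -catA; exact: Permutation_refl.
(* The edges of [numeral 0] are 0, 1, 2 and 5; positions 3 and 4 are fillers. *)
pose g w := nth 0 [:: f 1; f 4; f 3; 0; 0; f 5] w.
apply: (isval_pair (V := map (ren_node g) (nodes (numeral 0))) hW).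
  exact: (@isval_num 0 g).
by rewrite numeral_nodes spine0 apps0 /=; perm_solve.
Qed.

(** The term [fun f x => f (n f x)], with [n] at premise 0. Its contraction and dereliction become
    the head of the new spine, so two linear steps already yield a numeral and no box is opened. *)
Definition succ_gate :=
  [:: Rlol 1 2 3; Rlol 4 5 2; Xn 1 6 7; Dn 6 8; Llol 0 7 9; Llol 9 4 10;
      Llol 8 10 5].

Lemma computes_succ n : computes succ_gate 0 3 (VN n) (VN n.+1).
Proof.
move=> f W R k hW.
have [h [t [s e2 ea e5]]] := apply_num (f 7) (f 9) (f 4) (f 10)
  [:: Rlol (f 1) (f 2) (f 3), Rlol (f 4) (f 5) (f 2), Xn (f 1) (f 6) (f 7),
   Dn (f 6) (f 8), Llol (f 8) (f 10) (f 5) & R] k hW.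
(* Edges 0 to 5 of the new numeral come from the gate, the others from the old numeral, where their
   names are smaller by 4. *)
pose g w := if w < 6 then h (f (nth 0 [:: 3; 2; 1; 6; 8; 5] w)) else t (w - 4).
exists h, (map (ren_node g) (nodes (numeral n.+1))); split; last first.
  exact: (@isval_num n.+1 g).
have gt N : all (leq 2) (ins N ++ outs N) ->
    map (ren_node (g \o shift4)) N = map (ren_node t) N.
  move=> /allP ge2; apply: eq_in_map_ren => w /ge2; rewrite /g /shift4 /= => w2.
  by rewrite ltnNge (leq_add w2 (leqnn 4)) addnK.
apply: steps_perm_l _ (steps_perm_r s _); first by rewrite /=; perm_solve.
rewrite numeral_nodes spineS appsS.
move: (spine_wires_ge2 n) (apps_wires_ge2 n).
move: (spine n) (apps n) => S A S2 A2.
rewrite !(map_cat, map_cons) /= !map_ren_comp !gt //.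
have -> : g (4 * n.+1 + 5) = h (f 4).
  by rewrite -ea /g ifF; [congr t|]; lia.
rewrite (_ : g 6 = h (f 7)) // (_ : g 9 = h (f 10)) //.
by rewrite /=; perm_solve.
Qed.

(** * Iteration of a program *)

Definition iter_gate N c j :=
  [:: Lten 0 1 2; Llol 1 3 4; Llol 4 2 5; Box [::] (Rlol 0 c j :: N) j 3].

(** The situation after the box has been opened. Evaluation starts at the innermost application,
    which has the largest index: copies are consumed downwards while the state index [i] grows. *)
Lemma computes_loop N c j vs n i f (g : nat -> wire -> wire) V R k :
  (forall l, l < n -> computes N 0 c (vs (i + l)) (vs (i + l).+1)) ->
  (forall l, l < n -> g l j = f (4 * l + 4)) ->
  isval (vs i) (f (4 * n + 5)) V ->
  exists h V',
    steps (V ++ flatten (mkseq (fun l => map (ren_node (g l)) (Rlol 0 c j :: N)) n)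
             ++ map (ren_node f) (apps n) ++ R) k
          (V' ++ map (ren_node h) R) (h k)
    /\ isval (vs (i + n)) (h (f 5)) V'.
Proof.
elim: n i f g V R k => [|n IH] i f g V R k cN gj hV.
  exists id, V; rewrite map_ren_id addn0 apps0; split=> //; exact: steps_perm.
rewrite mkseqS -cats1 flatten_cat appsSr map_cat /= cats0 gj //.
pose h1 := merge (g n 0) (f (4 * n.+1 + 5)) (g n c) (f (4 * n + 5)).
set L := flatten _; set A := map _ (apps n).
have hV1 : isval (vs i) ((h1 \o g n) 0) (map (ren_node h1) V).
  by rewrite /= /h1 merge_l; exact: isval_ren.
have := cN 0 isT; rewrite addn0 => cN0.
(* The body of the last copy runs on the current value, with the remaining copies and applications
   as its surroundings. *)
have [h2 [V2 [s2 hV2]]] := cN0 _ _ (map (ren_node h1) (L ++ A ++ R)) (h1 k) hV1.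
pose h := h2 \o h1.
have hV2' : isval (vs i.+1) ((h \o f) (4 * n + 5)) V2.
  by move: hV2; rewrite /= {1}/h1 merge_r.
have cN' l : l < n -> computes N 0 c (vs (i.+1 + l)) (vs (i.+1 + l).+1).
  by move=> ln; rewrite addSnnS; exact: (cN l.+1).
have gj' l : l < n -> (h \o g l) j = (h \o f) (4 * l + 4).
  by move=> ln /=; rewrite gj // ltnW.
have [h3 [V3 [s3 hV3]]] := IH i.+1 (h \o f) (fun l => h \o g l) V2
   (map (ren_node h) R) (h k) cN' gj' hV2'.
exists (h3 \o h), V3; split; last by rewrite -addSnnS.
rewrite -map_ren_comp; apply: steps_trans s3.
have -> : map (ren_node (h \o f)) (apps n) = map (ren_node h) A.
  by rewrite map_ren_comp.
move: A s2 => A s2; apply: steps_step.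
  apply: (@step_lol _ k (g n 0) (g n c) (f (4 * n + 4)) (f (4 * n.+1 + 5))
     (f (4 * n + 5)) (V ++ map (ren_node (g n)) N ++ L ++ A ++ R)).
  by rewrite /=; perm_solve.
rewrite -/h1 !map_cat map_ren_comp.
apply: steps_perm_l _ (steps_perm_r s2 _); first by rewrite !map_cat; perm_solve.
rewrite !map_cat !map_ren_comp.
suff -> : map (ren_node (h2 \o h1)) L =
  flatten (mkseq (fun l => map (ren_node (h \o g l)) (Rlol 0 c j :: N)) n).
  by perm_solve.
rewrite map_flatten /mkseq -map_comp; congr flatten.
by apply: eq_map => l /=; rewrite map_ren_comp.
Qed.

Lemma computes_iter N c j vs n :
  (forall l, l < n -> computes N 0 c (vs l) (vs l.+1)) ->
  computes (iter_gate N c j) 0 5 (VP (VN n) (vs 0)) (vs n).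
Proof.
move=> cN f W R k hW /=; set B := Rlol _ _ _ :: N.
have [h [P [C [s hP hC]]]] := unpair (f 1) (f 2)
  [:: Llol (f 1) (f 3) (f 4), Llol (f 4) (f 2) (f 5), Box [::] B j (f 3) & R] k hW.
have [h' [t [s' e2 ea e5]]] := apply_num (h (f 3)) (h (f 4)) (h (f 2)) (h (f 5))
  (Box [::] B j (h (f 3)) :: C ++ map (ren_node h) R) (h k) hP.
pose os := mkseq (fun i => t (4 * i + 4)) n.
pose R' := map (ren_node (h' \o h)) R.
pose C' := map (ren_node h') C.
pose N0 := Box [::] B j (h' (h (f 3))) :: map (ren_node t) (spine n) ++
  map (ren_node t) (apps n) ++ C' ++ R'.
pose M := (foldr maxn 0 (outs N0)).+1.
have MP : all (fun w => w < M) (outs N0).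
  rewrite /M; elim: (outs N0) => //= w s0 IHs; rewrite ltnS leq_maxl /=.
  by apply: sub_all IHs => x /=; lia.
have hC' : isval (vs 0) (t (4 * n + 5)) C' by rewrite ea; exact: isval_ren.
have sos : size os = n by rewrite size_mkseq.
have gj l : l < n -> copy_wire M os j l j = t (4 * l + 4).
  by move=> ln; rewrite /copy_wire eqxx nth_mkseq.
have [h3 [V3 [s3 hV3]]] :=
  @computes_loop N c j vs n 0 t (copy_wire M os j) C' R' (h' (h k)) cN gj hC'.
exists (h3 \o (h' \o h)), V3; split; last by rewrite /= -e5.
rewrite -map_ren_comp; apply: steps_trans s _.
apply: steps_perm_l _ (steps_trans s' _); first by rewrite /=; perm_solve.
apply: (@steps_perm_l _ N0); first by rewrite /= (map_cat _ (spine n)) (map_cat _ C) map_ren_comp; perm_solve.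
apply: steps_step.
  apply: (@step_box N0 _ B j _ _ os _ _ M (Permutation_refl _) (derelicting_spine n)).
    by rewrite -e2; exact: spine_tree_at.
  exact: MP.
rewrite /copies sos; apply: steps_perm_l s3; perm_solve.
Qed.

Lemma computes_first N c d u u' v g :
  computes N 0 c u u' -> g 0 = 3 -> g c = d ->
  computes (Lten 0 3 1 :: Rten d 1 2 :: map (ren_node g) N) 0 2 (VP u v) (VP u' v).
Proof.
move=> cN g0 gc f W R k hW /=.
have [h [U [V [s hu hv]]]] := unpair (f 3) (f 1)
  (Rten (f d) (f 1) (f 2) :: map (ren_node f) (map (ren_node g) N) ++ R) k hW.
have hu' : isval u ((h \o f \o g) 0) U by rewrite /= g0.
have [h' [U' [s' hu2]]] := cN _ _
  (V ++ Rten (h (f d)) (h (f 1)) (h (f 2)) :: map (ren_node h) R) (h k) hu'.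
exists (h' \o h).
exists (Rten (h' (h (f d))) (h' (h (f 1))) (h' (h (f 2))) :: U' ++ map (ren_node h') V).
split=> /=.
  apply: steps_trans s _; apply: steps_perm_l _ (steps_perm_r s' _).
    by rewrite /= !map_cat !map_ren_comp; perm_solve.
  by rewrite /= !map_cat /= !map_ren_comp; perm_solve.
apply: isval_pair _ (isval_ren _ hv) (Permutation_refl _).
by rewrite -gc.
Qed.

(** * Combinators *)

(** The net is chosen before [t]: one program must serve the whole family of inputs. *)
Definition computable (T : Type) (a b : T -> val) : Prop :=
  exists N c, [/\ proof_net (Net [:: 0] N c), wf_net (Net [:: 0] N c)
                & forall t, computes N 0 c (a t) (b t)].

Section Combinators.
Variable T : Type.
Implicit Types a b c d : T -> val.

Lemma eq_computable a b a' b' :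
  a =1 a' -> b =1 b' -> computable a b -> computable a' b'.
Proof.
move=> ea eb [N [c [pn wf cN]]]; exists N, c; split=> // t.
by rewrite -ea -eb.
Qed.

Lemma computable_id a : computable a a.
Proof.
exists [::], 0; split=> //; first exact: pn_wire.
by move=> t; exact: computes_id.
Qed.

Lemma computable_comp a b c :
  computable a b -> computable b c -> computable a c.
Proof.
move=> [N1 [q [pn1 wf1 c1]]] [N2 [r [pn2 wf2 c2]]].
pose M := (foldr maxn 0 (0 :: outs N1)).+1.
have ltM : all (fun w => w < M) (0 :: outs N1).
  rewrite /M; elim: (0 :: outs N1) => //= w s IHs; rewrite ltnS leq_maxl /=.
  by apply: sub_all IHs => x /=; lia.
(* Glues the premise of the second net to the conclusion of the first and moves its other edges
   above [M]; it is injective because [q < M]. *)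
pose g (w : wire) : wire := if w == 0 then q else M + w.
move: (wf1); rewrite wf_netE => /and3P[u1 p1 a1].
move: (wf2); rewrite wf_netE => /and3P[u2 p2 a2].
have qM : q < M.
  by move/allP: ltM; apply; rewrite (perm_mem p1) inE eqxx.
have gi : injective g.
  by move=> u v; rewrite /g; case: eqP; case: eqP; lia.
have pn2' := proof_net_ren gi pn2.
have n0 : 0 \notin outs N2 by move: u2; rewrite /= => /andP[].
have wf : wf_net (Net [:: 0] (N1 ++ map (ren_node g) N2) (g r)).
  rewrite wf_netE outs_cat ins_cat all_cat outs_ren ins_ren all_wf_ren a1 a2 andbT.
  apply/andP; split.
    have u2' : uniq (outs N2) by move/andP: u2 => [].
    rewrite catA cat_uniq (map_inj_uniq gi) u2' andbT; apply/andP; split=> //.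
    apply/hasPn => _ /mapP[w wN2 ->]; apply/negP => gw.
    move/allP: ltM => /(_ _ gw); rewrite /g; case: eqP => [w0|_].
      by move: wN2; rewrite w0 (negPf n0).
    by rewrite ltnNge leq_addr.
  have p2' : perm_eq (q :: map g (outs N2)) (g r :: map g (ins N2)).
    exact: (perm_map g p2).
  rewrite andbT; apply/permP => P; move/permP: p1 => /(_ P); move/permP: p2' => /(_ P) /=.
  by rewrite !count_cat; lia.
exists (N1 ++ map (ren_node g) N2), (g r); split=> //.
  exact: (@pn_cut [:: 0] [::] _ _ q _ pn1 pn2' wf).
move=> t; apply: computes_comp (c1 t) _.
exact: (computes_ren (g := g) (c2 t)).
Qed.

Lemma computable_first a b d :
  computable a b -> computable (fun t => VP (a t) (d t)) (fun t => VP (b t) (d t)).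
Proof.
move=> [N [c [pn wf cN]]].
(* Frees 0, 1 and 2 for the surrounding tensor nodes and moves the premise to 3. *)
pose g (w : wire) : wire := w + 3.
have gi : injective g by move=> u v; rewrite /g; lia.
have pn' := proof_net_ren gi pn.
pose N' := map (ren_node g) N.
have : wf_net (Net [:: 3] N' (g c)) by exact: (wf_net_ren gi wf).
rewrite wf_netE /= => /and3P[/andP[n3 uN] pN aN].
have nN w : w < 3 -> w \notin outs N'.
  move=> w3; rewrite outs_ren; apply/negP => /mapP[x _ wx].
  by rewrite wx /g addnC ltnNge in w3.
have wf1 : wf_net (Net [:: 3; 1] (Rten (g c) 1 2 :: N') 2).
  rewrite wf_netE outs_cons ins_cons /= !inE (negPf n3) !(negPf (nN _ _)) //= uN aN.
  rewrite andbT; apply/permP => P; move/permP: pN => /(_ P) /=; lia.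
have wf2 : wf_net (Net [:: 0] (Lten 0 3 1 :: Rten (g c) 1 2 :: N') 2).
  rewrite wf_netE !(outs_cons, ins_cons) /= !inE (negPf n3) !(negPf (nN _ _)) //= uN aN.
  rewrite andbT; apply/permP => P; move/permP: pN => /(_ P) /=; lia.
exists (Lten 0 3 1 :: Rten (g c) 1 2 :: N'), 2; split=> //.
  apply: (pn_Lten (ps := [::])) => //.
  have := @pn_Rten [:: 3] [:: 1] N' [::] (g c) 1 2 pn' (pn_wire 1).
  by rewrite cats0; apply.
by move=> t; exact: computes_first (cN t) _ _.
Qed.

Lemma computable_swap a b :
  computable (fun t => VP (a t) (b t)) (fun t => VP (b t) (a t)).
Proof.
exists swap_gate, 3; split=> //; last by move=> t; exact: computes_swap.
apply: (pn_Lten (ps := [::])) => //.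
apply: (@proof_net_perm [:: 2; 1]) (Permutation_refl _) _ => //.
exact: (@pn_Rten [:: 2] [:: 1] [::] [::] 2 1 3 (pn_wire 2) (pn_wire 1)).
Qed.

Lemma computable_assoc a b c :
  computable (fun t => VP (VP (a t) (b t)) (c t))
             (fun t => VP (a t) (VP (b t) (c t))).
Proof.
exists assoc_gate, 6; split=> //; last by move=> t; exact: computes_assoc.
do 2![apply: (pn_Lten (ps := [:: 2])) => // || apply: (pn_Lten (ps := [::])) => //].
have h := @pn_Rten [:: 4] [:: 2] [::] [::] 4 2 5 (pn_wire 4) (pn_wire 2) isT.
apply: (@proof_net_perm [:: 3; 4; 2] _ [:: Rten 3 5 6; Rten 4 2 5]) => //.
  exact: perm_swap.
exact: (@pn_Rten [:: 3] [:: 4; 2] [::] [:: Rten 4 2 5] 3 5 6 (pn_wire 3) h).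
Qed.

Lemma computable_zero a : computable a (fun t => VP (a t) (VN 0)).
Proof.
exists zero_gate, 2; split=> //; last by move=> t; exact: computes_zero.
apply: (@pn_Rten [:: 0] [::] [::] [:: Rlol 3 4 1; Rlol 5 5 4; Wn 3] 0 1 2) => //.
  exact: pn_wire.
apply: pn_Rlol => //; apply: pn_Rlol => //.
apply: (@proof_net_perm [:: 3; 5]) (Permutation_refl _) _ => //.
by apply: pn_W => //; exact: pn_wire.
Qed.

Lemma computable_succ (n : T -> nat) :
  computable (fun t => VN (n t)) (fun t => VN (n t).+1).
Proof.
exists succ_gate, 3; split=> //; last by move=> t; exact: computes_succ.
(* The net is sequentialised from the outer application of [f] back to the abstractions. Rules act
   on the leading premises, hence the reorderings in between. *)
have s1 := @pn_Llol [:: 10] [::] [::] [::] 8 10 5 5 (pn_wire 10) (pn_wire 5) isT.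
have s1' := @proof_net_prems [:: 10; 8] _ _ _ s1 isT.
have s2 := @pn_Llol [:: 4] [:: 8] [::] [:: Llol 8 10 5] 9 4 10 5 (pn_wire 4) s1' isT.
have s3 := @pn_Llol [:: 7] [:: 4; 8] [::] [:: Llol 9 4 10; Llol 8 10 5] 0 7 9 5
  (pn_wire 7) s2 isT.
have s3' := @proof_net_prems [:: 8; 0; 7; 4] _ _ _ s3 isT.
have s4 := @pn_D [:: 0; 7; 4] _ 5 6 8 s3' isT.
have s4' := @proof_net_prems [:: 6; 7; 0; 4] _ _ _ s4 isT.
have s5 := @pn_X [:: 0; 4] _ 5 1 6 7 s4' isT.
have s5' := @proof_net_prems [:: 4; 1; 0] _ _ _ s5 isT.
have s6 := @pn_Rlol [:: 1; 0] _ 4 5 2 s5' isT.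
exact: (@pn_Rlol [:: 0] _ 1 2 3 s6 isT).
Qed.

End Combinators.

(** The step program is uniform in the state, so a single box content serves every intermediate
    state; abstracting its only premise closes the box. *)
Lemma computable_iter (S T : Type) (a : S -> val) (F : S -> S)
    (n : T -> nat) (s : T -> S) :
  computable a (a \o F) ->
  computable (fun t => VP (VN (n t)) (a (s t)))
             (fun t => a (iter (n t) F (s t))).
Proof.
move=> [N [c [pn wf cN]]].
pose j := (foldr maxn 0 (0 :: outs N)).+1.
have ltj : all (fun w => w < j) (0 :: outs N).
  rewrite /j; elim: (0 :: outs N) => //= w s0 IHs; rewrite ltnS leq_maxl /=.
  by apply: sub_all IHs => x /=; lia.
have jN : j \notin 0 :: outs N.
  by apply/negP => /(allP ltj); rewrite ltnn.
have wfB : wf_net (Net [::] (Rlol 0 c j :: N) j).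
  move: wf; rewrite !wf_netE outs_cons ins_cons /= => /and3P[/andP[n0 u] p ->].
  move: jN; rewrite !inE !negb_or eq_sym => /andP[-> jN].
  rewrite n0 jN u andbT /=.
  by rewrite andbT; apply/permP => P; move/permP: p => /(_ P) /=; lia.
have bx := @pn_box [::] _ j 3 (@pn_Rlol [::] N 0 c j pn wfB).
move: (wfB); rewrite /wf_net /= => /andP[wfp /= wfn].
(* Once the abstract content is settled, only concrete outer names remain, and computation decides
   their conditions. *)
have wfb ps M k : wf_ports ps (Box [::] (Rlol 0 c j :: N) j 3 :: M) k ->
    all wf_node M -> wf_net (Net ps (Box [::] (Rlol 0 c j :: N) j 3 :: M) k).
  by rewrite /wf_net /= wfp wfn => -> ->.
have {}bx := bx (wfb [::] [::] 3 isT isT).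
have r1 := @pn_Llol [:: 2] [::] [::] [::] 4 2 5 5 (pn_wire 2) (pn_wire 5) isT.
have wf1 : wf_net (Net [:: 1; 2] [:: Llol 1 3 4; Box [::] (Rlol 0 c j :: N) j 3; Llol 4 2 5] 5).
  rewrite (wf_net_perm _ (perm_refl _) (perm_swap _ _ _)).
  exact: (wfb [:: 1; 2] [:: Llol 1 3 4; Llol 4 2 5] 5).
have r2 := @pn_Llol [::] [:: 2] _ _ 1 3 4 5 bx r1 wf1.
have r2' : proof_net (Net [:: 1; 2] (behead (iter_gate N c j)) 5).
  by apply: proof_net_perm r2 => //=; perm_solve.
have wf2 : wf_net (Net [:: 0] (iter_gate N c j) 5).
  rewrite (@wf_net_perm _ [:: 0] _ (Box [::] (Rlol 0 c j :: N) j 3 ::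
     [:: Lten 0 1 2; Llol 1 3 4; Llol 4 2 5])) //.
  by rewrite /iter_gate; perm_solve.
exists (iter_gate N c j), 5; split=> //.
  exact: (@pn_Lten [::] _ 5 0 1 2 r2' wf2).
move=> t; apply: (@computes_iter N c j (fun l => a (iter l F (s t)))) => l _.
exact: cN.
Qed.

Section DerivedCombinators.
Variable T : Type.
Implicit Types a b c d : T -> val.

Lemma computable_reindex (S : Type) (u : T -> S) (a b : S -> val) :
  computable a b -> computable (a \o u) (b \o u).
Proof. by move=> [N [c [pn wf cN]]]; exists N, c; split=> // t; exact: cN. Qed.

Lemma computable_second a b d :
  computable a b -> computable (fun t => VP (d t) (a t)) (fun t => VP (d t) (b t)).
Proof.
move=> ab; apply: computable_comp (computable_swap _ _) _.
by apply: computable_comp (computable_first _ ab) _; exact: computable_swap.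
Qed.

(** [computable_assoc] conjugated by swaps: (a,(b,c)), ((b,c),a), ((c,b),a), (c,(b,a)), ((b,a),c),
    ((a,b),c). *)
Lemma computable_assocV a b c :
  computable (fun t => VP (a t) (VP (b t) (c t)))
             (fun t => VP (VP (a t) (b t)) (c t)).
Proof.
apply: computable_comp (computable_swap _ _) _.
apply: computable_comp (computable_first _ (computable_swap _ _)) _.
apply: computable_comp (computable_assoc _ _ _) _.
apply: computable_comp (computable_swap _ _) _.
exact: computable_first _ (computable_swap _ _).
Qed.

Lemma computable_erase_num (n : T -> nat) a :
  computable (fun t => VP (VN (n t)) (a t)) a.
Proof.
apply: eq_computable (computable_iter n id (computable_id a : computable a (a \o id))) => //.
by move=> t /=; congr a; elim: (n t).
Qed.

End DerivedCombinators.

Lemma computable_dup_num (T : Type) (n : T -> nat) :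
  computable (fun t => VN (n t)) (fun t => VP (VN (n t)) (VN (n t))).
Proof.
apply: computable_comp (computable_zero _) _.
apply: computable_comp (computable_second _ (computable_zero _)) _.
pose a k := VP (VN k) (VN k).
have st : computable a (a \o succn).
  rewrite /comp /a; apply: computable_comp (computable_first _ (computable_succ _)) _.
  exact: computable_second _ (computable_succ _).
apply: eq_computable (computable_iter n (fun=> 0) st) => // t.
by rewrite iter_succn_0.
Qed.

(** * Primitive recursive functions *)

(* The trailing zero makes the empty tuple a value too. *)
Definition enc (s : seq nat) : val := foldr (fun n v => VP (VN n) v) (VN 0) s.

Lemma enc_cons s m : size s = m.+1 -> enc s = VP (VN (head 0 s)) (enc (behead s)).
Proof. by case: s. Qed.

(** Entries are erased one at a time, down to the trailing zero. The length is common to all [t]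
    because it determines the net. *)
Lemma computable_erase (T : Type) m (s : T -> seq nat) (a : T -> val) :
  (forall t, size (s t) = m) -> computable (fun t => VP (enc (s t)) (a t)) a.
Proof.
elim: m s => [|m IH] s sm.
  apply: eq_computable (computable_erase_num (fun=> 0) a) => // t.
  by rewrite (size0nil (sm t)).
have sm' t : size (behead (s t)) = m by rewrite size_behead sm.
pose n t := head 0 (s t).
apply: (eq_computable (a := fun t => VP (VP (VN (n t)) (enc (behead (s t)))) (a t))) => //.
  by move=> t; rewrite (enc_cons (sm t)).
apply: computable_comp (computable_assoc _ _ _) _.
apply: computable_comp (computable_second _ (IH _ sm')) _.
exact: computable_erase_num.
Qed.

Lemma computable_dup (T : Type) m (s : T -> seq nat) :
  (forall t, size (s t) = m) ->
  computable (fun t => enc (s t)) (fun t => VP (enc (s t)) (enc (s t))).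
Proof.
elim: m s => [|m IH] s sm.
  by apply: eq_computable (computable_zero (fun=> VN 0)) => // t; rewrite (size0nil (sm t)).
have sm' t : size (behead (s t)) = m by rewrite size_behead sm.
pose n t := head 0 (s t); pose b t := enc (behead (s t)).
apply: (eq_computable (a := fun t => VP (VN (n t)) (b t))
  (b := fun t => VP (VP (VN (n t)) (b t)) (VP (VN (n t)) (b t)))).
- by move=> t; rewrite (enc_cons (sm t)).
- by move=> t; rewrite (enc_cons (sm t)).
apply: computable_comp (computable_first _ (computable_dup_num _)) _.
apply: computable_comp (computable_second _ (IH _ sm')) _.
(* Both parts are doubled; the shuffle is ((n,n),(b,b)), (n,(n,(b,b))), (n,((n,b),b)),
   (n,((b,n),b)), (n,(b,(n,b))), ((n,b),(n,b)). *)
apply: computable_comp (computable_assoc _ _ _) _.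
apply: computable_comp (computable_second _ (computable_assocV _ _ _)) _.
apply: computable_comp (computable_second _ (computable_first _ (computable_swap _ _))) _.
apply: computable_comp (computable_second _ (computable_assoc _ _ _)) _.
exact: computable_assocV.
Qed.

Lemma computable_proj m (i : 'I_m) :
  computable (fun t : m.-tuple nat => enc t) (fun t => VN (tnth t i)).
Proof.
(* Generalised to families of sequences, so that the induction can pass to [behead]. *)
suff H (T : Type) (j p : nat) (s : T -> seq nat) : j < p ->
    (forall t, size (s t) = p) ->
    computable (fun t => enc (s t)) (fun t => VN (nth 0 (s t) j)).
  apply: eq_computable (H _ i m (fun t : m.-tuple nat => t) (ltn_ord i) _) => // t.
    by rewrite (tnth_nth 0).
  exact: size_tuple.
elim: p j s => // p IH j s jp sm.
have sm' t : size (behead (s t)) = p by rewrite size_behead sm.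
apply: (eq_computable (a := fun t => VP (VN (head 0 (s t))) (enc (behead (s t))))
  (b := fun t => VN (nth 0 (s t) j))) => //.
  by move=> t; rewrite (enc_cons (sm t)).
case: j jp => [|j] jp.
  apply: computable_comp (computable_swap _ _) _.
  apply: computable_comp (computable_erase _ sm') _.
  by apply: eq_computable (computable_id _) => // t; rewrite nth0.
apply: computable_comp (computable_erase_num _ _) _.
apply: eq_computable (IH j _ jp sm') => // t.
by rewrite nth_behead.
Qed.

Lemma computable_const0 m :
  computable (fun t : m.-tuple nat => enc t) (fun=> VN 0).
Proof.
apply: computable_comp (computable_zero _) _.
by apply: computable_erase => t; exact: size_tuple.
Qed.

(** Each component consumes its own copy of the arguments; the last copy is turned into the trailing
    zero. *)
Lemma computable_tuple m (I : Type) (h : I -> m.-tuple nat -> nat) (l : seq I) :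
  (forall i, computable (fun t : m.-tuple nat => enc t) (fun t => VN (h i t))) ->
  computable (fun t : m.-tuple nat => enc t) (fun t => enc [seq h i t | i <- l]).
Proof.
move=> ch; elim: l => [|i l IH]; first exact: computable_const0.
apply: computable_comp (computable_dup (fun t => size_tuple t)) _.
apply: computable_comp (computable_first _ (ch i)) _.
exact: computable_second.
Qed.

Lemma computable_rec m (g : m.-tuple nat -> nat) (h : m.+2.-tuple nat -> nat) :
  computable (fun t : m.-tuple nat => enc t) (fun t => VN (g t)) ->
  computable (fun t : m.+2.-tuple nat => enc t) (fun t => VN (h t)) ->
  computable (fun t : m.+1.-tuple nat => enc t)
    (fun t => VN (nat_rect (fun=> nat) (g [tuple of behead t])
       (fun k r => h [tuple of k :: r :: [tuple of behead t]]) (thead t))).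
Proof.
move=> cg ch; pose S := (nat * nat * m.-tuple nat)%type.
pose arg (x : S) : m.+2.-tuple nat := [tuple of x.1.1 :: x.1.2 :: x.2].
pose st (x : S) := enc (arg x).
pose F (x : S) : S := (x.1.1.+1, h (arg x), x.2).
(* With [h] the new result: ((k,(r,s)),(k,(r,s))), (h,(k,(r,s))), (h,(k,s)), (h,(k+1,s)),
   ((h,k+1),s), ((k+1,h),s), (k+1,(h,s)). *)
have step : computable st (st \o F).
  apply: computable_comp (computable_dup (fun x => size_tuple (arg x))) _.
  apply: computable_comp (computable_first _ (computable_reindex arg ch)) _.
  apply: (computable_comp (b := fun x => VP (VN (h (arg x)))
            (VP (VN x.1.1) (enc x.2)))).
    apply: computable_second; apply: computable_second.
    exact: computable_erase_num.
  apply: computable_comp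
    (computable_second _ (computable_first _ (computable_succ _))) _.
  apply: computable_comp (computable_assocV _ _ _) _.
  apply: computable_comp (computable_first _ (computable_swap _ _)) _.
  exact: computable_assoc.
pose s (t : m.+1.-tuple nat) : m.-tuple nat := [tuple of behead t].
apply: (eq_computable (a := fun t => VP (VN (thead t)) (enc (s t)))) (frefl _) _.
  by move=> t; rewrite [in RHS](tuple_eta t).
(* The parameters are copied, once for [g] and once for the state; adding the counter 0 gives the
   initial state (0,(g s,s)), paired with the number of rounds. *)
apply: computable_comp
  (computable_second _ (computable_dup (fun t => size_tuple (s t)))) _.
apply: computable_comp
  (computable_second _ (computable_first _ (computable_reindex s cg))) _.
apply: computable_comp (computable_second _ (computable_zero _)) _.
apply: computable_comp (computable_second _ (computable_swap _ _)) _.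
apply: computable_comp
  (computable_iter (@thead m nat) (fun t => (0, g (s t), s t)) step) _.
pose r (t : m.+1.-tuple nat) k :=
  nat_rect (fun=> nat) (g (s t)) (fun k r => h [tuple of k :: r :: s t]) k.
apply: (eq_computable
  (a := fun t => VP (VN (thead t)) (VP (VN (r t (thead t))) (enc (s t))))
  (b := fun t => VN (r t (thead t)))) => //.
  (* The loop invariant: after [k] rounds the state holds [k] and the value of the recursion at
     [k]. *)
  move=> t; suff -> k : iter k F (0, g (s t), s t) = (k, r t k, s t) by [].
  by elim: k => //= k ->.
apply: computable_comp (computable_erase_num _ _) _.
apply: computable_comp (computable_swap _ _) _.
by apply: computable_erase => t; exact: size_tuple.
Qed.

Lemma computable_primitive_recursive m (f : m.-tuple nat -> nat) :
  primitive_recursive f ->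
  computable (fun t : m.-tuple nat => enc t) (fun t => VN (f t)).
Proof.
elim=> {m f}.
- exact: computable_const0.
(* The projection strips the trailing zero from the encoded 1-tuple. *)
- have := computable_proj (@ord0 0) => /computable_comp; apply.
  by apply: eq_computable (computable_succ _) => // t; rewrite /thead.
- exact: computable_proj.
- move=> k m g h _ cg _ ch; apply: computable_comp (computable_tuple (enum 'I_k) ch) _.
  apply: eq_computable (computable_reindex (fun t => [tuple h i t | i < k]) cg) => //.
- by move=> m g h _ cg _ ch; exact: computable_rec.
- by move=> m f g fg _ cf; apply: eq_computable cf => // t; rewrite fg.
Qed.

(* The encoding used by [numerals]. *)
Fixpoint encn (n : nat) (ns : seq nat) : val :=
  if ns is n' :: ns' then VP (VN n) (encn n' ns') else VN n.

(** The encodings differ only at the last entry, where a zero is appended. *)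
Lemma computable_encn (T : Type) m (n : T -> nat) (s : T -> seq nat) :
  (forall t, size (s t) = m) ->
  computable (fun t => encn (n t) (s t)) (fun t => enc (n t :: s t)).
Proof.
elim: m n s => [|m IH] n s sm.
  apply: eq_computable (computable_zero (fun t => VN (n t))) => t;
  by rewrite (size0nil (sm t)).
have sm' t : size (behead (s t)) = m by rewrite size_behead sm.
apply: eq_computable (computable_second (fun t => VN (n t))
  (IH (fun t => head 0 (s t)) _ sm')) => t; by case: (s t) (sm t).
Qed.

(** * Well-formedness and recognition of numerals *)

Lemma numeral_outs n : perm_eq (outs (spine n ++ apps n)) (iota 3 (4 * n)).
Proof.
elim: n => // n IH; rewrite spineS appsS mulnS (iotaD 3 4) (iotaDl 4 3) /=.
rewrite 2!outs_cons outs_cat outs_cons !outs_ren /=.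
rewrite (eq_map (fun w => addnC 4 w : 4 + w = shift4 w)).
apply/permP => P; move/permP: (perm_map shift4 IH) => /(_ P).
rewrite outs_cat map_cat /= !count_cat /=.
by rewrite /wire; lia.
Qed.

Lemma numeral_perm n :
  perm_eq (2 :: 4 * n + 5 :: outs (spine n ++ apps n))
          (5 :: ins (spine n ++ apps n)).
Proof.
elim: n => // n IH; rewrite spineS appsS /=.
rewrite 2!outs_cons 2!ins_cons outs_cat ins_cat outs_cons ins_cons.
rewrite !outs_ren !ins_ren /=.
apply/permP => P; move/permP: (perm_map shift4 IH) => /(_ P).
rewrite outs_cat ins_cat /= !map_cat !count_cat /=.
have -> : shift4 (4 * n + 5) = 4 * n.+1 + 5 by rewrite /shift4; lia.
by rewrite (_ : shift4 2 = 6) // (_ : shift4 5 = 9) // /wire; lia.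
Qed.

Lemma wf_numeral n : wf_net (numeral n).
Proof.
have -> : numeral n = Net [::] (nodes (numeral n)) 0 by [].
rewrite wf_netE numeral_nodes !outs_cons !ins_cons; apply/and3P; split.
- have p : perm_eq [:: 2, 0, 4 * n + 5, 1 & outs (spine n ++ apps n)]
                    [:: 2, 0, 4 * n + 5, 1 & iota 3 (4 * n)].
    by rewrite !perm_cons numeral_outs.
  suff: uniq [:: 2, 0, 4 * n + 5, 1 & iota 3 (4 * n)] by rewrite -(perm_uniq p).
  by rewrite /= !inE !mem_iota iota_uniq; lia.
- apply/permP => P; move/permP: (numeral_perm n) => /(_ P) /=; lia.
- have body : all wf_node (spine n ++ apps n).
    elim: n => // n IH; rewrite spineS appsS /= all_cat /= !all_wf_ren.
    by rewrite all_cat in IH.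
  exact: body.
Qed.

(** [net_iso] asks for a globally injective renaming, so the inverse on the finite image is extended
    by sending all other names above [s]. *)
Lemma finite_left_inverse (s : seq nat) (f : nat -> nat) : uniq (map f s) ->
  exists2 g, injective g & {in s, cancel f g}.
Proof.
move=> ufs; have us := map_uniq ufs.
pose M := (foldr maxn 0 s).+1.
have ltM : {in s, forall w, w < M}.
  apply/allP; rewrite /M; elim: (s) => //= w s0 IHs; rewrite ltnS leq_maxl /=.
  by apply: sub_all IHs => x /=; lia.
pose g u := if u \in map f s then nth 0 s (index u (map f s)) else M + u.
have gs u : u \in map f s -> index u (map f s) < size s.
  by rewrite -index_mem size_map.
exists g => [u v|w ws].
  rewrite /g; case: ifP => hu; case: ifP => hv.
  - move/eqP; rewrite nth_uniq ?gs // => /eqP e.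
    by rewrite -(nth_index 0 hu) -(nth_index 0 hv) e.
  - by move=> e; have := ltM _ (mem_nth 0 (gs _ hu)); rewrite e ltnNge leq_addr.
  - by move=> e; have := ltM _ (mem_nth 0 (gs _ hv)); rewrite -e ltnNge leq_addr.
  - exact: addnI.
rewrite /g map_f //.
have iw : index w s < size s by rewrite index_mem.
have -> : index (f w) (map f s) = index w s.
  have := @index_uniq _ 0 (index w s) (map f s).
  by rewrite size_map (nth_map 0) // nth_index // => ->.
exact: nth_index.
Qed.

(** Sources in [V] are distinct, so the renaming is injective on the sources of the numeral; these
    are all its edges, as a closed well-formed net has no others. Inverting it gives the
    isomorphism. *)
Lemma isval_net_iso n k V : isval (VN n) k V -> wf_net (Net [::] V k) ->
  net_iso (Net [::] V k) (numeral n).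
Proof.
move=> /isval_numE[f -> p]; rewrite wf_netE /= => /and3P[u _ _].
have := wf_numeral n; rewrite (_ : numeral n = Net [::] (nodes (numeral n)) 0) //.
move: (nodes (numeral n)) p => N p; rewrite wf_netE => /and3P[_ pN _].
have uf : uniq (map f (outs N)).
  by rewrite -outs_ren -(perm_uniq (perm_flatten node_out p)).
have [g gi gf] := finite_left_inverse uf.
have g0 : g (f 0) = 0 by apply: gf; rewrite (perm_mem pN) inE eqxx.
rewrite -[in Net _ N 0]g0; apply: net_iso_ren => //.
apply: Permutation_sym.
apply: Permutation_trans (Permutation_map_ren g p) _.
rewrite map_ren_comp -[X in Permutation _ X]map_ren_id.
rewrite (@eq_in_map_ren _ id) // => w wN; apply: gf.
move: wN; rewrite mem_cat => /orP[wN|//].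
by rewrite (perm_mem pN) inE wN orbT.
Qed.

(** * Tuples of numerals and plugging *)

Lemma tensorP u v G H :
  [/\ prems G = [::], wf_net G & isval u (concl G) (nodes G)] ->
  [/\ prems H = [::], wf_net H & isval v (concl H) (nodes H)] ->
  let K := tensor G H in
  [/\ prems K = [::], wf_net K & isval (VP u v) (concl K) (nodes K)].
Proof.
case: G => ps N k [/= -> wfG vG]; case: H => qs N' k' [/= -> wfH vH].
pose f := fun w : wire => w.*2.+1; pose g := fun w : wire => w.*2.+2.
have fi : injective f by move=> x y; rewrite /f; lia.
have gi : injective g by move=> x y; rewrite /g; lia.
split=> //; last exact: isval_pair (isval_ren f vG) (isval_ren g vH) (Permutation_refl _).
have := wf_net_ren fi wfG; have := wf_net_ren gi wfH.
rewrite !wf_netE outs_cons ins_cons outs_cat ins_cat /= all_cat.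
move=> /and3P[u1 p1 ->] /and3P[u2 p2 ->] /=; rewrite andbT; apply/andP; split.
  rewrite mem_cat negb_or cat_uniq u1 u2 !outs_ren andbT -andbA.
  apply/and3P; split; try by apply/mapP => -[x _].
  by apply/hasPn => _ /mapP[x _ ->]; apply/mapP => -[y _]; rewrite /f /g; lia.
apply/permP => P; move/permP: p1 => /(_ P); move/permP: p2 => /(_ P).
by rewrite /f /g /= !count_cat /wire; lia.
Qed.

Lemma numeralsP n ns : let G := numerals n ns in
  [/\ prems G = [::], wf_net G & isval (encn n ns) (concl G) (nodes G)].
Proof.
have nP m : [/\ prems (numeral m) = [::], wf_net (numeral m)
    & isval (VN m) (concl (numeral m)) (nodes (numeral m))].
  split=> //; first exact: wf_numeral.
  by apply: (@isval_num m id); rewrite map_ren_id.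
elim: ns n => [|n' ns IH] n; first exact: nP.
exact: (tensorP (nP n) (IH n')).
Qed.

Lemma wf_plug N c H : wf_net (Net [:: 0] N c) -> prems H = [::] -> wf_net H ->
  wf_net (plug (Net [:: 0] N c) H).
Proof.
case: H => qs N' k' wfG /= -> wfH; rewrite /plug /=.
(* The two renamings of the plugged net combined. It is injective and meets the even names only at
   0, the shared edge. *)
pose f (w : wire) : wire := if w == k' then 0 else w.*2.+1.
have fi : injective f by move=> x y; rewrite /f; case: eqP; case: eqP; lia.
have fk : f k' = 0 by rewrite /f eqxx.
have di : injective double by move=> x y; lia.
rewrite map_ren_comp (@eq_map_ren _ f); last first.
  by move=> w; rewrite /= /subst /f eqSS (inj_eq di).
have := wf_net_ren fi wfH; have := wf_net_ren di wfG.
rewrite !wf_netE outs_cat ins_cat all_cat /= fk.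
move=> /and3P[/andP[n0 u1] p1 ->] /and3P[u2 p2 ->] /=; rewrite andbT; apply/andP; split.
  rewrite cat_uniq u1 u2 andbT; apply/hasPn => w w1; apply/negP => w2.
  move: w1 w2 n0; rewrite !outs_ren => /mapP[x xN ->] /mapP[y _].
  rewrite /f; case: eqP => [_ e|_]; last by lia.
  by rewrite (_ : 0.*2 = x.*2) ?map_f.
apply/permP => P; move/permP: p1 => /(_ P); move/permP: p2 => /(_ P).
by rewrite double0 /= !count_cat; lia.
Qed.

Theorem mainTheorem4 (m : nat) (f : m.+1.-tuple nat -> nat)
    (hf : primitive_recursive f) :
  exists G : net,
    [/\ proof_net G, size (prems G) = 1
      & forall t : m.+1.-tuple nat,
          superlazy_star (plug G (numerals (thead t) (behead t)))
                         (numeral (f t))].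
Proof.
pose s (t : m.+1.-tuple nat) : m.-tuple nat := [tuple of behead t].
have cf : computable (fun t : m.+1.-tuple nat => encn (thead t) (behead t))
                     (fun t => VN (f t)).
  have := computable_encn (@thead m nat) (fun t => size_tuple (s t)).
  move=> /computable_comp; apply.
  apply: eq_computable (computable_primitive_recursive hf) => // t.
  by rewrite {1}(tuple_eta t).
have [N [c [pn wf cN]]] := cf; exists (Net [:: 0] N c); split=> // t.
have [pH wfH vH] := numeralsP (thead t) (behead t).
have := wf_plug wf pH wfH.
case: (numerals _ _) pH vH wfH => /= qs H k -> vH _; rewrite /plug /= => wfp.
(* Plugging sends the conclusion of the tuple to 0, which is also the doubled premise of the
   program. *)
have vH' := isval_ren (subst k.*2.+1 0) (isval_ren (fun w => w.*2.+1) vH).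
rewrite {1}/subst eqxx in vH'.
(* With empty surroundings, the computed value is the whole resulting net. *)
have [h [V [st hV]]] := cN t double _ [::] c.*2 vH'.
rewrite !cats0 in st.
have [V' [r p wfV]] := steps_superlazy st wfp.
exists (Net [::] V' (h c.*2)) => //.
apply: isval_net_iso (isval_perm p hV) _.
by rewrite (wf_net_perm _ (perm_refl _) p).
Qed.
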